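(* Let $\mathcal{C}$ be a category (or $\infty$-category) with finite limits, let $X \colon \Upsilon^{\mathrm{op}} \to \mathcal{C}$ be a symmetric simplicial object in $\mathcal{C}$, and let $k$ be a positive integer. The following are equivalent: (1) $X$ is lower $(2k-1)$-Segal; (2) $X$ is lower $2k$-Segal; (3) $X$ is upper $2k$-Segal; (4) $X$ is upper $(2k+1)$-Segal.
   Context: $\Upsilon$ is the category with objects $[n]=\{0,1,\dots,n\}$, $n\ge0$, and all functions as morphisms; $\mathbf{\Delta}\subset\Upsilon$ is the subcategory of order-preserving maps. A symmetric simplicial object in $\mathcal{C}$ is a functor $\Upsilon^{\mathrm{op}}\to\mathcal{C}$; it is said to satisfy one of the Segal conditions below if its underlying simplicial object (restriction to $\mathbf{\Delta}^{\mathrm{op}}$) does. A simplicial object $X$ is regarded as a functor on nonempty finite subsets of $\mathbb{N}$ and order-preserving maps, via the unique order isomorphism of a set $\{i_0<\dots<i_n\}$ with $[n]$; write $X_S$ for its value on $S$. For a proper subset $I\subset[n]$, let $X\langle I\rangle$ be the cube from the power set $\mathcal{P}(I)$ to $\mathcal{C}$ given by $J\mapsto X_{[n]\setminus J}$, with maps induced by the inclusions $[n]\setminus J'\subseteq[n]\setminus J$ for $J\subseteq J'$. A cube is cartesian if it is a limit diagram, i.e. its value at $\varnothing$ is the limit of its restriction to the nonempty subsets. A subset $I\subset[n]$ is gapped if distinct elements of $I$ differ by at least $2$. For $k\ge1$ consider the gapped subsets $I\subset[n]$ of cardinality $k+1$, for all $n\ge0$. $X$ is: lower $(2k-1)$-Segal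 if $X\langle I\rangle$ is cartesian for all such $I$; lower $2k$-Segal if $X\langle I\rangle$ is cartesian whenever $0\notin I$; upper $2k$-Segal if $X\langle I\rangle$ is cartesian whenever $n\notin I$; upper $(2k+1)$-Segal if $X\langle I\rangle$ is cartesian whenever $0\notin I$ and $n\notin I$. *)

(* Defs.v *)
From mathcomp Require Import all_boot.
From Stdlib Require Import FunctionalExtensionality ProofIrrelevance.
From Stdlib Require List.

Set Implicit Arguments.
Unset Strict Implicit.
Unset Printing Implicit Defensive.

Record category := Category {
  ob :> Type;
  hom : ob -> ob -> Type;
  idm : forall a, hom a a;
  cmp : forall a b c, hom b c -> hom a b -> hom a c;
  cmp_idl : forall a b (f : hom a b), cmp (idm b) f = f;
  cmp_idr : forall a b (f : hom a b), cmp f (idm a) = f;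
  cmpA : forall a b c d (h : hom c d) (g : hom b c) (f : hom a b),
    cmp h (cmp g f) = cmp (cmp h g) f }.

Arguments hom {c} _ _ : rename.
Arguments idm {c} _ : rename.
Arguments cmp {c a b c0} _ _ : rename.

Record functor (A B : category) := Functor {
  fob :> A -> B;
  fmap : forall a b, hom a b -> hom (fob a) (fob b);
  fmap_id : forall a, fmap (idm a) = idm (fob a);
  fmap_cmp : forall a b c (g : hom b c) (f : hom a b),
    fmap (cmp g f) = cmp (fmap g) (fmap f) }.

Arguments fmap {A B} f {a b} _ : rename.

Lemma Functor_eq (A B : category) (o : A -> B)
    (m m' : forall a b, hom a b -> hom (o a) (o b)) i i' c c' :
  (forall a b (f : hom a b), m a b f = m' a b f) ->
  Functor (fmap := m) i c = Functor (fmap := m') i' c'.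
Proof.
move=> e.
have em : m = m' by do 3![apply: functional_extensionality_dep => ?]; exact: e.
by subst m'; rewrite (proof_irrelevance _ i i') (proof_irrelevance _ c c').
Qed.

Definition fcomp (A B C : category) (G : functor B C) (F : functor A B) :
  functor A C.
Proof.
exists (fun a => G (F a)) (fun a b f => fmap G (fmap F f)).
- by move=> a; rewrite !fmap_id.
- by move=> a b c g f; rewrite !fmap_cmp.
Defined.

Definition op (A : category) : category.
Proof.
exists A (fun a b => @hom A b a) (@idm A) (fun a b c g f => cmp f g).
- by move=> a b f; exact: cmp_idr.
- by move=> a b f; exact: cmp_idl.
- by move=> a b c d h g f; rewrite cmpA.
Defined.

Definition op_functor (A B : category) (F : functor A B) :
  functor (op A) (op B).
Proof.
exists (fun a : op A => F a : op B) (fun a b f => fmap F f).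
- by move=> a; exact: fmap_id.
- by move=> a b c g f; exact: fmap_cmp.
Defined.

Definition preorder_cat (T : Type) (r : rel T) (rr : reflexive r)
  (rt : transitive r) : category.
Proof.
exists T (fun x y => r x y) rr (fun x y z (g : r y z) (f : r x y) => rt y x z f g);
  by move=> *; exact: bool_irrelevance.
Defined.

Lemma preorder_functor_eq (A : category) (T : Type) (r : rel T)
    (rr : reflexive r) (rt : transitive r)
    (F G : functor A (preorder_cat rr rt)) :
  (forall a, F a = G a) -> F = G.
Proof.
case: F G => [o m i c] [o' m' i' c'] /= e.
have eo : o = o' by apply: functional_extensionality => a; exact: e.
by subst o'; apply: Functor_eq => a b f; exact: bool_irrelevance.
Qed.

Record cone (J C : category) (D : functor J C) := Cone {
  apex : C;
  leg : forall j, hom apex (D j);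
  leg_nat : forall i j (f : hom i j), cmp (fmap D f) (leg i) = leg j }.

Definition is_limit (J C : category) (D : functor J C) (l : cone D) : Prop :=
  forall l' : cone D, exists! u : hom (apex l') (apex l),
    forall j, cmp (leg l j) u = leg l' j.

Definition finite_type (T : Type) : Prop :=
  exists s : seq T, forall x, List.In x s.

Definition finite_category (J : category) : Prop :=
  finite_type J /\ forall a b : J, finite_type (hom a b).

Definition has_finite_limits (C : category) : Prop :=
  forall J : category, finite_category J ->
  forall D : functor J C, exists l : cone D, is_limit l.

(* The object [n] = {0, ..., n} is represented by the natural number n and
   its underlying set by 'I_n.+1. *)

Record mono (m n : nat) := Mono {
  mfun :> 'I_m.+1 -> 'I_n.+1;
  mono_homo : forall i j : 'I_m.+1, i <= j -> mfun i <= mfun j }.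

Lemma mono_eq m n (f g : mono m n) : (forall i, f i = g i) -> f = g.
Proof.
case: f g => [f hf] [g hg] /= e.
have efg : f = g by apply: functional_extensionality.
by subst g; rewrite (proof_irrelevance _ hf hg).
Qed.

Definition mono_id n : mono n n := @Mono n n id (fun _ _ h => h).

Definition mono_comp m n p (g : mono n p) (f : mono m n) : mono m p :=
  @Mono m p (fun i => g (f i)) (fun _ _ h => mono_homo g (mono_homo f h)).

Definition Delta : category.
Proof. by exists nat mono mono_id mono_comp => *; exact: mono_eq. Defined.

Definition Upsilon : category.
Proof.
by exists nat (fun m n => 'I_m.+1 -> 'I_n.+1) (fun _ => id)
  (fun m n p (g : 'I_n.+1 -> 'I_p.+1) (f : 'I_m.+1 -> 'I_n.+1) i => g (f i)).
Defined.

Definition Delta_to_Upsilon : functor Delta Upsilon.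
Proof. by exists (fun n : Delta => n : Upsilon) mfun. Defined.

Record sset := SSet {
  simp :> nat -> Type;
  res : forall m n, mono m n -> simp n -> simp m;
  res_id : forall n (x : simp n), res (mono_id n) x = x;
  res_comp : forall m n p (g : mono n p) (f : mono m n) (x : simp p),
    res (mono_comp g f) x = res f (res g x) }.

Arguments res {s m n} _ _ : rename.

Record smap (K L : sset) := SMap {
  sfun :> forall n, K n -> L n;
  sfun_res : forall m n (f : mono m n) (x : K n),
    sfun (res f x) = res f (sfun x) }.

Arguments sfun {K L} _ {n} _.

Definition scomp (K L M : sset) (v : smap L M) (u : smap K L) : smap K M.
Proof.
exists (fun n x => sfun v (sfun u x)).
by move=> m n f x; rewrite !sfun_res.
Defined.

Definition nondegenerate (K : sset) n (x : K n) : Prop :=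
  ~ exists m (f : mono n m) (y : K m), m < n /\ x = res f y.

Definition finite_sset (K : sset) : Prop :=
  exists s : seq {n : nat & K n}, forall n (x : K n),
    nondegenerate x -> List.In (existT (fun n => K n) n x) s.

(* The n-simplices of the union of those facets of the standard simplex Delta^m
   that are opposite to a vertex satisfying [o]. *)
Record facets_simplex (m : nat) (o : pred 'I_m.+1) (n : nat) := FacetsSimplex {
  facets_mono : mono n m;
  facets_miss : exists2 j, o j & forall i, facets_mono i != j }.

Lemma facets_simplex_eq m (o : pred 'I_m.+1) n (f g : facets_simplex o n) :
  (forall i, facets_mono f i = facets_mono g i) -> f = g.
Proof.
case: f g => [f hf] [g hg] /= /mono_eq efg.
by subst g; rewrite (proof_irrelevance _ hf hg).
Qed.

Definition facets_res m (o : pred 'I_m.+1) n n' (g : mono n n')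
  (f : facets_simplex o n') : facets_simplex o n.
Proof.
exists (mono_comp (facets_mono f) g).
by case: (facets_miss f) => j oj hj; exists j => // i; exact: hj.
Defined.

Definition facets (m : nat) (o : pred 'I_m.+1) : sset.
Proof.
by exists (facets_simplex o) (@facets_res m o) => *; exact: facets_simplex_eq.
Defined.

Definition boundary (m : nat) : sset := facets (m := m) predT.

Definition horn (m : nat) (k : 'I_m.+1) : sset := facets (predC1 k).

(* By the Yoneda lemma, an extension to Delta^m is an m-simplex of X. *)
Definition extends (m : nat) (o : pred 'I_m.+1) (X : sset)
    (b : smap (facets o) X) : Prop :=
  exists s : X m, forall n (f : facets o n), sfun b f = res (facets_mono f) s.

Definition quasicategory (C : sset) : Prop :=
  forall (m : nat) (k : 'I_m.+1), 0 < k < m ->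
  forall b : smap (horn k) C, extends b.

(* A vertex x is final when, for all m > 0, every map from the boundary of
   Delta^m to X whose value on the last vertex is x extends to Delta^m. *)
Definition final_vertex (X : sset) (x : X 0) : Prop :=
  forall (m : nat) (b : smap (boundary m.+1) X),
    (forall v : boundary m.+1 0, facets_mono v ord0 = ord_max -> sfun b v = x) ->
    extends b.

(* The ordinal sum of [m] and [n] is [m + n.+1]. *)

Definition inl_mono m n : mono m (m + n.+1).
Proof. by exists (lshift n.+1 : 'I_m.+1 -> 'I_(m.+1 + n.+1)). Defined.

Definition inr_mono m n : mono n (m + n.+1).
Proof.
exists (@rshift m.+1 n.+1 : 'I_n.+1 -> 'I_(m.+1 + n.+1)).
by move=> i j h /=; rewrite leq_add2l.
Defined.

Definition join_fun m n m' n' (f : 'I_m.+1 -> 'I_m'.+1)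
    (g : 'I_n.+1 -> 'I_n'.+1) (i : 'I_(m.+1 + n.+1)) : 'I_(m'.+1 + n'.+1) :=
  match split i with
  | inl a => lshift n'.+1 (f a)
  | inr b => rshift m'.+1 (g b)
  end.

Definition join_mono m n m' n' (f : mono m m') (g : mono n n') :
  mono (m + n.+1) (m' + n'.+1).
Proof.
exists (join_fun f g) => i j le_ij; rewrite /join_fun.
case: (@splitP m.+1 n.+1 i) => a ea; case: (@splitP m.+1 n.+1 j) => b eb /=.
- by apply: mono_homo; rewrite -ea -eb.
- by apply: leq_trans (ltnW (ltn_ord (f a))) (leq_addr _ _).
- by have := ltn_ord b; rewrite -eb ltnNge (leq_trans _ le_ij) // ea leq_addr.
- by rewrite leq_add2l; apply: mono_homo; rewrite -(leq_add2l m.+1) -ea -eb.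
Defined.

Lemma join_mono_id m n : join_mono (mono_id m) (mono_id n) = mono_id (m + n.+1).
Proof.
apply: mono_eq => i; rewrite /= /join_fun; apply: val_inj => /=.
by case: (@splitP m.+1 n.+1 i) => a ->.
Qed.

Lemma join_mono_comp m n m' n' m'' n'' (f' : mono m' m'') (g' : mono n' n'')
    (f : mono m m') (g : mono n n') :
  join_mono (mono_comp f' f) (mono_comp g' g)
  = mono_comp (join_mono f' g') (join_mono f g).
Proof.
apply: mono_eq => i; rewrite /= /join_fun.
case: (@splitP m.+1 n.+1 i) => a _.
- by rewrite (unsplitK (inl (f a) : 'I_m'.+1 + 'I_n'.+1)).
- by rewrite (unsplitK (inr (g a) : 'I_m'.+1 + 'I_n'.+1)).
Qed.

Lemma join_mono_inl m n m' n' (f : mono m m') (g : mono n n') :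
  mono_comp (join_mono f g) (inl_mono m n) = mono_comp (inl_mono m' n') f.
Proof.
by apply: mono_eq => i; rewrite /= /join_fun
  (unsplitK (inl i : 'I_m.+1 + 'I_n.+1)).
Qed.

Lemma join_mono_inr m n m' n' (f : mono m m') (g : mono n n') :
  mono_comp (join_mono f g) (inr_mono m n) = mono_comp (inr_mono m' n') g.
Proof.
by apply: mono_eq => i; rewrite /= /join_fun
  (unsplitK (inr i : 'I_m.+1 + 'I_n.+1)).
Qed.

(* An m-simplex of C_{/p} is a map from the join of Delta^m and K to C that
   restricts to p on K. The simplices of this join are those of Delta^m, those
   of K, and the faces and degeneracies of the joins of id_[m] with the
   simplices x of K; so the map is given by its value [sl_base] on id_[m] and by
   its values [sl_join x] on the latter. *)
Record slice_simplex (K C : sset) (p : smap K C) (m : nat) := SliceSimplex {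
  sl_base : C m;
  sl_join : forall n, K n -> C (m + n.+1);
  sl_nat : forall n n' (g : mono n n') (x : K n'),
    sl_join (res g x) = res (join_mono (mono_id m) g) (sl_join x);
  sl_inl : forall n (x : K n), res (inl_mono m n) (sl_join x) = sl_base;
  sl_inr : forall n (x : K n), res (inr_mono m n) (sl_join x) = sfun p x }.

Lemma slice_simplex_eq (K C : sset) (p : smap K C) m
    (s t : slice_simplex p m) :
  sl_base s = sl_base t ->
  (forall n (x : K n), sl_join s x = sl_join t x) -> s = t.
Proof.
case: s t => [b j h1 h2 h3] [b' j' h1' h2' h3'] /= eb ej.
have e : j = j' by do 2![apply: functional_extensionality_dep => ?]; exact: ej.
subst b' j'.
by rewrite (proof_irrelevance _ h1 h1') (proof_irrelevance _ h2 h2')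
  (proof_irrelevance _ h3 h3').
Qed.

Definition slice_res (K C : sset) (p : smap K C) m m' (f : mono m m')
  (s : slice_simplex p m') : slice_simplex p m.
Proof.
exists (res f (sl_base s))
  (fun n x => res (join_mono f (mono_id n)) (sl_join s x)).
- move=> n n' g x; rewrite sl_nat -!res_comp -!join_mono_comp.
  by congr (res (join_mono _ _) _); apply: mono_eq.
- by move=> n x; rewrite -res_comp join_mono_inl res_comp sl_inl.
- by move=> n x; rewrite -res_comp join_mono_inr res_comp sl_inr res_id.
Defined.

Definition slice (K C : sset) (p : smap K C) : sset.
Proof.
exists (slice_simplex p) (@slice_res K C p).
- move=> m s; apply: slice_simplex_eq => [|n x] /=; first exact: res_id.
  by rewrite join_mono_id res_id.
- move=> m n q g f s; apply: slice_simplex_eq => [|r x] /=.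
    exact: res_comp.
  by rewrite -res_comp -join_mono_comp.
Defined.

(* A vertex of [slice p] is a cone over p. *)
Definition is_infty_limit (K C : sset) (p : smap K C) (l : slice p 0) : Prop :=
  final_vertex l.

Definition has_finite_infty_limits (C : sset) : Prop :=
  forall K : sset, finite_sset K ->
  forall p : smap K C, exists l : slice p 0, is_infty_limit l.

Definition chain (n : nat) : category :=
  @preorder_cat 'I_n.+1 (fun i j => i <= j) (fun i => leqnn i)
    (fun j i k => @leq_trans j i k).

Definition chain_functor m n (f : mono m n) : functor (chain m) (chain n).
Proof.
by exists (mfun f : chain m -> chain n) (@mono_homo m n f)
  => *; exact: bool_irrelevance.
Defined.

Definition nerve (A : category) : sset.
Proof.
exists (fun n => functor (chain n) A) (fun m n f x => fcomp x (chain_functor f)).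
- move=> n [o m i c]; apply: Functor_eq => a b f /=.
  by congr (m a b _); exact: bool_irrelevance.
- move=> m n p g f x; apply: Functor_eq => a b h /=.
  by congr (fmap x _); exact: bool_irrelevance.
Defined.

Definition nerve_map (A B : category) (F : functor A B) :
  smap (nerve A) (nerve B).
Proof.
exists (fun n (x : nerve A n) => fcomp F x : nerve B n).
by move=> m n f x; exact: Functor_eq.
Defined.

Section Cubes.
Variables (T : finType) (I : {set T}).

Definition powerset_cat : category :=
  @preorder_cat {J : {set T} | J \subset I}
    (fun J J' => sval J \subset sval J') (fun J => subxx (sval J))
    (fun J' J J'' => @subset_trans _ (sval J) (sval J') (sval J'')).

Definition nonempty_powerset_cat : category :=
  @preorder_cat {J : {set T} | (J \subset I) && (J != set0)}
    (fun J J' => sval J \subset sval J') (fun J => subxx (sval J))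
    (fun J' J J'' => @subset_trans _ (sval J) (sval J') (sval J'')).

Definition nonempty_incl : functor nonempty_powerset_cat powerset_cat.
Proof.
exists (fun J : nonempty_powerset_cat =>
    exist _ (sval J) (proj1 (andP (svalP J))) : powerset_cat)
  (fun J J' h => h) => *; exact: bool_irrelevance.
Defined.

Definition empty_vertex : powerset_cat := exist _ set0 (sub0set I).

Definition empty_to (J : powerset_cat) : hom empty_vertex J :=
  sub0set (sval J).

(* The value of a cube on the empty set, as a cone over the restriction of the
   cube to the nonempty subsets. *)
Definition cube_cone (C : category) (F : functor powerset_cat C) :
  cone (fcomp F nonempty_incl).
Proof.
exists (F empty_vertex) (fun J => fmap F (empty_to (nonempty_incl J))).
move=> J J' h; rewrite /= -fmap_cmp.
by congr (fmap F _); exact: bool_irrelevance.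
Defined.

Definition cartesian (C : category) (F : functor powerset_cat C) : Prop :=
  is_limit (cube_cone F).

Definition cons_empty_fun n (x : nerve nonempty_powerset_cat n)
    (i : 'I_(1 + n.+1)) : powerset_cat :=
  match split i with
  | inl _ => empty_vertex
  | inr j => nonempty_incl (x j)
  end.

Definition cons_empty n (x : nerve nonempty_powerset_cat n) :
  nerve powerset_cat (0 + n.+1).
Proof.
unshelve refine
  (@Functor (chain (0 + n.+1)) powerset_cat (cons_empty_fun x) _ _ _);
  try by move=> *; exact: bool_irrelevance.
move=> i j le_ij; rewrite /cons_empty_fun.
case: (@splitP 1 n.+1 i) => a ea; first exact: sub0set.
case: (@splitP 1 n.+1 j) => b eb.
  have : i < 1 by rewrite (leq_ltn_trans le_ij) // eb ltn_ord.
  by rewrite ea.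
have le_ab : hom (a : chain n) b by rewrite /= -(leq_add2l 1) -ea -eb.
exact: (fmap x le_ab).
Defined.

Definition empty_simplex : nerve powerset_cat 0.
Proof.
by exists (fun _ : chain 0 => empty_vertex) (fun _ _ _ => idm empty_vertex)
  => *; exact: bool_irrelevance.
Defined.

Definition infty_cube_cone (C : sset) (F : smap (nerve powerset_cat) C) :
  slice (scomp F (nerve_map nonempty_incl)) 0.
Proof.
exists (sfun F empty_simplex) (fun n x => sfun F (cons_empty x)).
- move=> n n' g x; rewrite -sfun_res; congr (sfun F _).
  apply: preorder_functor_eq => i.
  rewrite /= /cons_empty_fun /join_fun.
  case: (@splitP 1 n.+1 i) => a _.
  + by rewrite (unsplitK (inl a : 'I_1 + 'I_n'.+1)).
  + by rewrite (unsplitK (inr (g a) : 'I_1 + 'I_n'.+1)).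
- move=> n x; rewrite -sfun_res; congr (sfun F _).
  apply: preorder_functor_eq => i.
  by rewrite /= /cons_empty_fun (unsplitK (inl i : 'I_1 + 'I_n.+1)).
- move=> n x; rewrite -sfun_res /=; congr (sfun F _).
  apply: preorder_functor_eq => i.
  by rewrite /= /cons_empty_fun (unsplitK (inr i : 'I_1 + 'I_n.+1)).
Defined.

Definition infty_cartesian (C : sset) (F : smap (nerve powerset_cat) C) : Prop :=
  is_infty_limit (infty_cube_cone F).

End Cubes.

Section SubsetsOfOrdinals.
Variable n : nat.
Implicit Types S U : {set 'I_n.+1}.

Definition dim S : nat := #|S|.-1.

(* [enum S] lists S in increasing order, so for nonempty S the following two
   functions are the order isomorphism from [dim S] to S and its inverse. *)
Definition elt S (a : 'I_(dim S).+1) : 'I_n.+1 := nth ord0 (enum S) a.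
Definition pos S (i : 'I_n.+1) : 'I_(dim S).+1 := inord (index i (enum S)).

Lemma dimS S : S != set0 -> (dim S).+1 = #|S|.
Proof. by rewrite -card_gt0 /dim => /prednK. Qed.

Lemma elt_in S (a : 'I_(dim S).+1) : S != set0 -> elt a \in S.
Proof. by move=> S0; rewrite -mem_enum mem_nth // -cardE -dimS. Qed.

Lemma val_pos S i : i \in S -> pos S i = index i (enum S) :> nat.
Proof.
move=> iS; have S0 : S != set0 by apply/set0Pn; exists i.
by rewrite inordK // dimS // cardE index_mem mem_enum.
Qed.

Lemma posK S i : i \in S -> elt (pos S i) = i.
Proof. by move=> iS; rewrite /elt val_pos // nth_index // mem_enum. Qed.

Lemma eltK S (a : 'I_(dim S).+1) : S != set0 -> pos S (elt a) = a.
Proof.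
move=> S0; apply: val_inj; rewrite /= val_pos ?elt_in //.
by rewrite index_uniq ?enum_uniq // -cardE -dimS.
Qed.

Lemma enum_sorted S : sorted ltn (map val (enum S)).
Proof.
rewrite sorted_map {1}/enum_mem; apply: sorted_filter.
  by move=> j i k /=; exact: ltn_trans.
by rewrite -enumT -sorted_map val_enum_ord iota_ltn_sorted.
Qed.

Lemma elt_lt S (a b : 'I_(dim S).+1) : S != set0 -> a < b -> elt a < elt b.
Proof.
move=> S0 lt_ab; have sz (c : 'I_(dim S).+1) : c < size (enum S).
  by rewrite -cardE -dimS.
rewrite /elt -!(nth_map ord0 0 val) ?sz //.
apply: (sorted_ltn_nth ltn_trans _ (enum_sorted S)) => //;
  by rewrite inE size_map sz.
Qed.

Lemma elt_le S (a b : 'I_(dim S).+1) : S != set0 -> (elt a <= elt b) = (a <= b).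
Proof.
move=> S0; case: (ltngtP a b) => [ltab|ltba|/val_inj->]; last exact: leqnn.
- exact/ltnW/elt_lt.
- by apply/negbTE; rewrite -ltnNge elt_lt.
Qed.

Definition incl_mono S U (S0 : S != set0) (SU : S \subset U) :
  mono (dim S) (dim U).
Proof.
exists (fun a : 'I_(dim S).+1 => pos U (elt a)) => a b le_ab.
have U0 : U != set0 by apply: contraNneq S0 => U0; rewrite -subset0 -U0.
by rewrite -elt_le // !posK ?elt_le ?(subsetP SU) ?elt_in.
Defined.

Variables (I : {set 'I_n.+1}) (properI : I \proper [set: 'I_n.+1]).

Lemma compl_neq0 (J : powerset_cat I) : ~: sval J != set0.
Proof.
case/properP: properI => _ [x _ xI]; apply/set0Pn; exists x.
by rewrite inE; apply: contra xI; apply/subsetP; exact: svalP J.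
Qed.

Lemma complS (J J' : powerset_cat I) :
  hom J J' -> ~: sval J' \subset ~: sval J.
Proof. by rewrite setCS. Qed.

Definition cube_shape : functor (powerset_cat I) (op Delta).
Proof.
exists (fun J => dim (~: sval J) : op Delta)
  (fun J J' h => incl_mono (compl_neq0 J') (complS h)).
- by move=> J; apply: mono_eq => a /=; exact/eltK/compl_neq0.
- move=> J J' J'' g f; apply: mono_eq => a /=; rewrite posK //.
  by apply: (subsetP (complS g)); apply/elt_in/compl_neq0.
Defined.

End SubsetsOfOrdinals.

Definition cube (C : category) (X : functor (op Delta) C) n
    (I : {set 'I_n.+1}) (properI : I \proper [set: 'I_n.+1]) :
    functor (powerset_cat I) C :=
  fcomp X (cube_shape properI).

Definition infty_cube (C : sset) (X : smap (nerve (op Delta)) C) n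
    (I : {set 'I_n.+1}) (properI : I \proper [set: 'I_n.+1]) :
    smap (nerve (powerset_cat I)) C :=
  scomp X (nerve_map (cube_shape properI)).

Definition underlying (C : category) (X : functor (op Upsilon) C) :
    functor (op Delta) C :=
  fcomp X (op_functor Delta_to_Upsilon).

Definition infty_underlying (C : sset) (X : smap (nerve (op Upsilon)) C) :
    smap (nerve (op Delta)) C :=
  scomp X (nerve_map (op_functor Delta_to_Upsilon)).

Definition gapped n (I : {set 'I_n.+1}) : Prop :=
  forall i j, i \in I -> j \in I -> i < j -> i.+2 <= j.

Definition cube_property : Type :=
  forall n (I : {set 'I_n.+1}), I \proper [set: 'I_n.+1] -> Prop.

Definition cartesian_cubes (C : category) (X : functor (op Delta) C) :
    cube_property :=
  fun n I properI => cartesian (cube X properI).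

Definition infty_cartesian_cubes (C : sset) (X : smap (nerve (op Delta)) C) :
    cube_property :=
  fun n I properI => infty_cartesian (infty_cube X properI).

(* With P = [cartesian_cubes X] or [infty_cartesian_cubes X], these say that X is
   lower (2k-1)-Segal, lower 2k-Segal, upper 2k-Segal and upper (2k+1)-Segal. *)
Section Segal.
Variables (P : cube_property) (k : nat).

Definition lower_odd_Segal : Prop :=
  forall n (I : {set 'I_n.+1}) (properI : I \proper [set: 'I_n.+1]),
    gapped I -> #|I| = k.+1 -> P properI.

Definition lower_even_Segal : Prop :=
  forall n (I : {set 'I_n.+1}) (properI : I \proper [set: 'I_n.+1]),
    gapped I -> #|I| = k.+1 -> ord0 \notin I -> P properI.

Definition upper_even_Segal : Prop :=
  forall n (I : {set 'I_n.+1}) (properI : I \proper [set: 'I_n.+1]),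
    gapped I -> #|I| = k.+1 -> ord_max \notin I -> P properI.

Definition upper_odd_Segal : Prop :=
  forall n (I : {set 'I_n.+1}) (properI : I \proper [set: 'I_n.+1]),
    gapped I -> #|I| = k.+1 -> ord0 \notin I -> ord_max \notin I -> P properI.

End Segal.

(* Main.v *)
(* For a proper subset I of [n] with k+1 elements, the injection
   x |-> 2x + (1 if x in I else 0) of [n] into [2n+2] maps I to a set I' of odd
   numbers, which is gapped and avoids both ends, and it maps the complement of I
   to the complement of I'. It has a retraction with the same two properties.
   These maps are not monotone, but they act on a symmetric object X and make the
   cube X<I> a retract of X<I'>. So everything follows from the fact that a
   retract of a limit cone is a limit cone.

   In a quasicategory this is proved as follows. A retract diagram F -> G -> F of
   cones is a map H on (poset) x Delta^2 whose restriction to the edge 0 -> 2 is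
   degenerate. A boundary problem for F is copied to the levels 0 and 2, and
   extended to level 1 by a left anodyne extension. There it is a boundary problem
   for G; its solution is extended to level 2 by another left anodyne extension,
   and the restriction to level 2 solves the original problem. *)
Require Import Defs.
From mathcomp Require Import all_boot.
From Stdlib Require Import FunctionalExtensionality.

Set Implicit Arguments.
Unset Strict Implicit.
Unset Printing Implicit Defensive.

(** * Partial maps on the chains of a finite poset *)

Record finposet := FinPoset {
  carrier :> finType;
  ple : rel carrier;
  ple_refl : reflexive ple;
  ple_anti : antisymmetric ple;
  ple_trans : transitive ple }.

Definition poset_cat (P : finposet) : category :=
  preorder_cat (@ple_refl P) (@ple_trans P).

Section Chains.
Variable P : finposet.

Definition vtx n (x : nerve (poset_cat P) n) (i : 'I_n.+1) : P := fob x i.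

Lemma vtx_le n (x : nerve (poset_cat P) n) (i j : 'I_n.+1) :
  i <= j -> ple (vtx x i) (vtx x j).
Proof. exact: (@fmap _ _ x i j). Qed.

Lemma chain_eq n (x y : nerve (poset_cat P) n) : vtx x =1 vtx y -> x = y.
Proof.
exact: (@preorder_functor_eq (chain n) P (@ple P) (@ple_refl P) (@ple_trans P) x y).
Qed.

Definition mkchain n (f : 'I_n.+1 -> P)
  (f_le : forall i j : 'I_n.+1, i <= j -> ple (f i) (f j)) :
  nerve (poset_cat P) n.
Proof. by exists (f : chain n -> poset_cat P) f_le => *; exact: bool_irrelevance. Defined.

Definition verts n (x : nerve (poset_cat P) n) : {set P} := [set vtx x i | i in 'I_n.+1].

Lemma vtx_in n (x : nerve (poset_cat P) n) i : vtx x i \in verts x.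
Proof. exact: imset_f. Qed.

Lemma verts_res m n (f : mono m n) (x : nerve (poset_cat P) n) :
  verts (res f x) \subset verts x.
Proof. by apply/subsetP => _ /imsetP[i _ ->]; exact: vtx_in. Qed.

Definition is_chain (S : {set P}) := forall x y, x \in S -> y \in S -> ple x y || ple y x.

Lemma verts_chain n (x : nerve (poset_cat P) n) : is_chain (verts x).
Proof.
move=> _ _ /imsetP[i _ ->] /imsetP[j _ ->].
by case/orP: (leq_total i j) => /(vtx_le x)->; rewrite ?orbT.
Qed.

Lemma is_chainS (S S' : {set P}) : S \subset S' -> is_chain S' -> is_chain S.
Proof. by move=> /subsetP sSS' cS x y /sSS' xS' /sSS'; exact: cS. Qed.

(** The rank of x, one less than the number of elements of S below x, identifies S with [m]. It is
    defined and monotone on all of P, so composing with it turns every chain of P into a map of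
    ordinals without side conditions. *)
Lemma chain_enum (S : {set P}) : is_chain S -> S != set0 ->
  exists m (e : nerve (poset_cat P) m) (p : P -> 'I_m.+1),
    [/\ forall i, vtx e i \in S, forall x, x \in S -> vtx e (p x) = x,
        forall i, p (vtx e i) = i & forall x y, ple x y -> p x <= p y].
Proof.
move=> cS S0; have [z zS] := set0Pn _ S0.
pose below x := [set y in S | ple y x].
pose p x : 'I_(#|S|.-1).+1 := inord #|below x|.-1.
have S1 : (#|S|.-1).+1 = #|S| by rewrite prednK // card_gt0.
have below_le x y : ple x y -> below x \subset below y.
  move=> xy; apply/subsetP => t; rewrite !inE => /andP[-> tx].
  exact: ple_trans tx xy.
have val_p x : p x = #|below x|.-1 :> nat.
  rewrite inordK // ltnS -!subn1 leq_sub2r // subset_leq_card //.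
  by apply/subsetP => t; rewrite inE => /andP[].
have p_le x y : ple x y -> p x <= p y.
  by move=> xy; rewrite !val_p -!subn1 leq_sub2r // subset_leq_card ?below_le.
have below_in x : x \in S -> x \in below x by move=> xS; rewrite inE xS ple_refl.
have p_lt x y : x \in S -> y \in S -> ple x y -> x != y -> p x < p y.
  move=> xS yS xy nxy; rewrite !val_p.
  have c0 t : t \in S -> 0 < #|below t|.
    by move=> tS; apply/card_gt0P; exists t; exact: below_in.
  rewrite -ltnS !prednK ?c0 // proper_card //; apply/properP; split.
    exact: below_le.
  exists y; first exact: below_in.
  rewrite inE yS; apply: contra nxy => yx; apply/eqP/ple_anti.
  by rewrite xy.
have p_inj : {in S &, injective p}.
  move=> x y xS yS pxy; apply/eqP; apply: contraT => nxy.
  case/orP: (cS x y xS yS) => h.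
  - by have := p_lt _ _ xS yS h nxy; rewrite pxy ltnn.
  - by rewrite eq_sym in nxy; have := p_lt _ _ yS xS h nxy; rewrite pxy ltnn.
have p_onto i : exists2 x, x \in S & p x = i.
  have : i \in p @: S.
    suff -> : p @: S = [set: 'I_(#|S|.-1).+1] by rewrite inE.
    by apply/eqP; rewrite eqEcard subsetT (card_in_imset p_inj) cardsT card_ord S1 leqnn.
  by case/imsetP => x xS ->; exists x.
pose e i := odflt z [pick x in S | p x == i].
have e_in i : e i \in S by rewrite /e; case: pickP => [x /andP[]|].
have pe i : p (e i) = i.
  rewrite /e; case: pickP => [x /andP[_ /eqP] //|/= none].
  by have [x xS pxi] := p_onto i; have := none x; rewrite xS pxi eqxx.
have e_le (i j : 'I_(#|S|.-1).+1) : i <= j -> ple (e i) (e j).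
  move=> ij; case/orP: (cS _ _ (e_in i) (e_in j)) => // h.
  have := p_le _ _ h; rewrite !pe => ji.
  have -> : i = j by apply/val_inj/anti_leq; rewrite ij.
  exact: ple_refl.
exists #|S|.-1, (mkchain e_le), p; split=> //.
by move=> x xS; apply: p_inj; rewrite ?pe // e_in.
Qed.

(** When S is closed under subsets, this is a simplicial map on the subcomplex of the chains with
    vertex set in S. Keeping [g] total, with arbitrary values elsewhere, avoids dependent types. *)
Definition natural_on (C : sset) (S : pred {set P})
    (g : forall n, nerve (poset_cat P) n -> C n) : Prop :=
  forall m n (f : mono m n) (x : nerve (poset_cat P) n), S (verts x) ->
    g m (res f x) = res f (g n x).

Definition down_closed (S : pred {set P}) : Prop :=
  forall A B : {set P}, A \subset B -> S B -> S A.

(** * Inner horns and inner anodyne extensions *)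

Section Filling.
Variables (C : sset) (quasiC : quasicategory C).

(** A spans a nondegenerate simplex whose facets other than the one opposite v are known; by [lo]
    and [hi], v is neither its first nor its last vertex. A chain in A that is not in S can miss at
    most v, so filling this inner horn adds just two vertex sets. *)
Lemma fill_horn (S : pred {set P}) (A : {set P}) (v lo hi : P)
    (g : forall n, nerve (poset_cat P) n -> C n) :
  down_closed S -> is_chain A -> lo \in A -> v \in A -> hi \in A ->
  ple lo v -> lo != v -> ple v hi -> v != hi ->
  (forall w, w \in A -> w != v -> S (A :\ w)) -> ~~ S (A :\ v) ->
  natural_on S g ->
  exists2 g' : forall n, nerve (poset_cat P) n -> C n,
    natural_on (fun B => [|| S B, B == A | B == A :\ v]) g' &
    forall n (x : nerve (poset_cat P) n), S (verts x) -> g' n x = g n x.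
Proof.
move=> downS cA loA vA hiA lov nlov vhi nvhi facesS nSv natg.
have A0 : A != set0 by apply/set0Pn; exists v.
have [m [e [p [e_in ep pe p_le]]]] := chain_enum cA A0.
have p_lt x y : x \in A -> y \in A -> ple x y -> x != y -> p x < p y.
  move=> xA yA xy nxy; rewrite ltn_neqAle p_le // andbT.
  by apply: contra nxy => /eqP/val_inj pxy; rewrite -(ep x) // pxy ep.
have k_inner : 0 < p v < m.
  rewrite (leq_ltn_trans _ (p_lt _ _ loA vA lov nlov)) //=.
  have := p_lt _ _ vA hiA vhi nvhi; have := ltn_ord (p hi).
  by rewrite ltnS => h /leq_trans; apply.
have S_facet n (f : mono n m) (j : 'I_m.+1) : j != p v -> (forall i, f i != j) ->
    S (verts (res f e)).
  move=> jk fj; apply: (@downS _ (A :\ vtx e j)).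
    apply/subsetP => _ /imsetP[i _ ->]; rewrite !inE e_in andbT.
    by apply: contra (fj i) => /eqP eij; rewrite -(pe (f i)) -[j]pe -eij.
  by apply: facesS => //; apply: contra jk => /eqP<-; rewrite pe.
pose b n (f : horn (p v) n) := g n (res (facets_mono f) e).
have b_nat m' n (f : mono m' n) (x : horn (p v) n) : b m' (res f x) = res f (b n x).
  rewrite /b /= -natg; last by case: (facets_miss x) => j; exact: S_facet.
  by congr (g _ _); exact: chain_eq.
have [s hs] := quasiC k_inner (SMap b_nat).
pose pm n (x : nerve (poset_cat P) n) : mono n m :=
  Mono (fun i j ij => p_le _ _ (vtx_le x ij)).
exists (fun n x => if S (verts x) then g n x else res (pm n x) s); last first.
  by move=> n x ->.
move=> m' n f x Sx.
have [Sgx|nSgx] := boolP (S (verts x)).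
  by rewrite (downS _ _ (verts_res f x) Sgx) natg.
rewrite (negbTE nSgx) /= in Sx.
have xA : verts x \subset A.
  by case/orP: Sx => /eqP-> //; exact: subsetDl.
have [Sgfx|_] := boolP (S _); last by rewrite -res_comp; congr (res _ s); exact: mono_eq.
(* A face of a new chain that lies in S misses some w other than v, since S does not contain
   [A :\ v]. So it belongs to the horn, on which the filler restricts to g. *)
have [w wA /andP[wv wx]] : exists2 w, w \in A & (w != v) && (w \notin verts (res f x)).
  apply/exists_inP; apply: contraT; rewrite negb_exists_in => /forall_inP h.
  case/negP: nSv; apply: downS Sgfx; apply/subsetP => w.
  by rewrite !inE => /andP[wv wA]; have := h w wA; rewrite wv /= negbK.
have miss : exists2 j : 'I_m.+1, predC1 (p v) j & forall i, mono_comp (pm n x) f i != j.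
  exists (p w).
    by rewrite /=; apply: contra wv => /eqP pwv; rewrite -(ep w) // pwv ep.
  move=> i /=; apply: contra wx => /eqP pwx.
  by rewrite -(ep w) // -pwx ep ?(vtx_in (res f x)) // (subsetP xA) ?vtx_in.
have /= := hs _ (FacetsSimplex miss); rewrite res_comp => <-.
rewrite /b /=; congr (g _ _); apply: chain_eq => i.
by rewrite /vtx /= -/(vtx _ _) -/(vtx e _) ep // (subsetP xA) ?vtx_in.
Qed.

Definition lowest (L : {pred P}) (A : {set P}) (y : P) :=
  [&& y \in A, y \in L & [forall z in A, (z \in L) ==> ple y z]].

Lemma lowest_uniq (L : {pred P}) (A : {set P}) y z :
  lowest L A y -> lowest L A z -> y = z.
Proof.
move=> /and3P[yA yL /forall_inP hy] /and3P[zA zL /forall_inP hz].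
by apply: ple_anti; rewrite (implyP (hy z zA)) // (implyP (hz y yA)).
Qed.

(** Among the elements of A in L, one with the fewest elements of A below it is the minimum. *)
Lemma lowest_ex (L : {pred P}) (A : {set P}) y :
  is_chain A -> y \in A -> y \in L -> exists z, lowest L A z.
Proof.
move=> cA yA yL; pose D := [pred z in A | z \in L].
have Dy : D y by rewrite inE yA.
case: (@arg_minnP _ y D (fun z => #|[set t in A | ple t z]|) Dy) => z.
move=> /andP[zA zL] zmin; exists z; apply/and3P; split=> //.
apply/forall_inP => t tA; apply/implyP => tL.
case/orP: (cA _ _ zA tA) => // tz.
have zt : #|[set u in A | ple u z]| <= #|[set u in A | ple u t]|.
  by apply: zmin; rewrite inE tA.
have sub : [set u in A | ple u t] \subset [set u in A | ple u z].
  apply/subsetP => u; rewrite !inE => /andP[-> ut].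
  exact: ple_trans ut tz.
have /setP/(_ z) : [set u in A | ple u t] = [set u in A | ple u z].
  by apply/eqP; rewrite eqEcard sub.
by rewrite !inE zA ple_refl.
Qed.

(* An inner anodyne extension. The missing chains are matched in pairs that
   differ by the vertex d y, where y is the lowest vertex in L; by [d_max], adding
   d y keeps a chain. The larger member of each pair fills an inner horn. *)
Lemma extend_down (L : {pred P}) (d : P -> P) (S S' : pred {set P})
    (g : forall n, nerve (poset_cat P) n -> C n) :
  (forall y, y \in L -> ple (d y) y) -> (forall y, d y \notin L) ->
  (forall y z, y \in L -> z \notin L -> ple z y -> ple z (d y)) ->
  down_closed S -> down_closed S' ->
  (forall A, is_chain A -> S' A -> ~~ S A ->
    (exists2 y, y \in A & y \in L) /\
    forall y, lowest L A y ->
      [/\ exists2 z, z \in A & ple z (d y) && (z != d y),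
          S' (d y |: A) & ~~ S (A :\ d y)]) ->
  natural_on S g ->
  exists2 g' : forall n, nerve (poset_cat P) n -> C n,
    natural_on S' g' &
    forall n (x : nerve (poset_cat P) n), S (verts x) -> g' n x = g n x.
Proof.
move=> d_le dL d_max downS downS'.
pose chainb (A : {set P}) := [forall x in A, forall y in A, ple x y || ple y x].
have chainP A : reflect (is_chain A) (chainb A).
  apply: (iffP forall_inP) => [h x y xA yA|h x xA].
    exact: (forall_inP (h x xA)).
  by apply/forall_inP => y; exact: h.
(* Induction on the number of missing vertex sets; each round fills one horn. *)
pose gap (S : pred {set P}) := [set A | [&& chainb A, S' A & ~~ S A]].
have [N] := ubnP #|gap S|; elim: N S g downS => // N IH S g downS ltN gapS natg.
have [gap0|[A0]] := set_0Vmem (gap S).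
  exists g => // m n f x S'x; apply: natg; apply: contraT => nSx.
  have : verts x \in gap S by rewrite inE S'x nSx !andbT; apply/chainP/verts_chain.
  by rewrite gap0 inE.
(* By the minimality of y and [d_max], [d y] is comparable with all of A. Since [d y] is outside L,
   y is still the lowest vertex in L after the addition, so A and [d y |: A] belong to the same
   pair. *)
have gapP A : A \in gap S -> exists y, [/\ lowest L A y, d y |: A \in gap S &
    lowest L (d y |: A) y].
  rewrite inE => /and3P[/chainP cA S'A nSA].
  have [[y0 y0A y0L] hA] := gapS A cA S'A nSA.
  have [y ly] := lowest_ex cA y0A y0L; exists y.
  have [_ S'dA _] := hA y ly; have [yA yL /forall_inP ymin] := and3P ly.
  have d_comp z : z \in A -> ple (d y) z || ple z (d y).
    move=> zA; have [zL|zL] := boolP (z \in L).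
      by rewrite (ple_trans (d_le y yL)) // (implyP (ymin z zA)).
    case/orP: (cA _ _ yA zA) => [yz|zy]; first by rewrite (ple_trans (d_le y yL)).
    by rewrite (d_max y z) // orbT.
  split=> //; last first.
    apply/and3P; split=> //; first by rewrite !inE yA orbT.
    apply/forall_inP => z; rewrite !inE => /orP[/eqP->|zA].
      by rewrite (negbTE (dL y)).
    exact: ymin.
  rewrite inE S'dA; apply/andP; split.
    apply/chainP => z t; rewrite !inE => /orP[/eqP->|zA] /orP[/eqP->|tA].
    - by rewrite ple_refl.
    - exact: d_comp.
    - by rewrite orbC d_comp.
    - exact: cA.
  by apply: contra nSA; apply: downS; exact: subsetUr.
(* The larger members of the pairs. *)
pose cand A := (A \in gap S) && [exists y, lowest L A y && (d y \in A)].
(* Vertices in L count twice, so that replacing one of them by a vertex outside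
   L decreases the measure. *)
pose mu (A : {set P}) := #|A| + #|[set z in A | z \in L]|.
have gap_cand A y : A \in gap S -> lowest L A y -> cand (d y |: A).
  move=> /gapP[y' [ly' gap_y' ly2]] ly; rewrite (lowest_uniq ly ly').
  rewrite /cand gap_y'; apply/existsP; exists y'.
  by rewrite ly2 !inE eqxx.
move=> A0gap; have [y0 [ly0 _ _]] := gapP _ A0gap.
case: (@arg_minnP _ (d y0 |: A0) cand mu (gap_cand _ _ A0gap ly0)) => A.
move=> /andP[gapA /existsP[y /andP[ly vA]]] minA.
move: (gapA); rewrite inE => /and3P[/chainP cA S'A nSA].
have [_ /(_ y ly)[[lo loA /andP[lov nlov]] _ nSv]] := gapS A cA S'A nSA.
have [yA yL /forall_inP ymin] := and3P ly.
have nvy : d y != y by apply: contraNneq (dL y) => ->.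
(* If [A :\ w] were missing, it would yield a candidate of smaller measure: for w = y, a vertex in L
   has been exchanged for at most one outside L; otherwise y stays lowest and [A :\ w], which
   contains [d y], is itself the candidate. *)
have faces w : w \in A -> w != d y -> S (A :\ w).
  move=> wA wv; apply: contraT => nSw.
  have gapw : A :\ w \in gap S.
    rewrite inE nSw (downS' _ _ (subsetDl A [set w]) S'A) !andbT.
    by apply/chainP/(is_chainS (subsetDl A [set w])).
  have [y' [ly' _ _]] := gapP _ gapw.
  have := minA _ (gap_cand _ _ gapw ly'); rewrite leqNgt => /negP; case.
  have cardA := cardsD1 w A; rewrite wA in cardA.
  have [wy|wy] := eqVneq w y.
    rewrite /mu -addnS leq_add //; first by rewrite cardsU1 cardA leq_add2r leq_b1.
    apply: proper_card; apply/properP; split.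
      apply/subsetP => z; rewrite !inE => /andP[/orP[/eqP->|/andP[_ ->] //]].
      by rewrite (negbTE (dL _)).
    exists y; first by rewrite inE yA.
    rewrite !inE yL -wy eqxx /= andbT orbF.
    by apply: contra (dL y') => /eqP <-; rewrite wy.
  have ly1 : lowest L (A :\ w) y.
    apply/and3P; split=> //; first by rewrite !inE eq_sym wy.
    by apply/forall_inP => z; rewrite !inE => /andP[_]; exact: ymin.
  rewrite (lowest_uniq ly' ly1).
  have /setUidPr -> : [set d y] \subset A :\ w.
    by rewrite sub1set !inE eq_sym wv.
  rewrite /mu -addSn leq_add // ?cardA //; apply: subset_leq_card.
  by apply/subsetP => z; rewrite !inE => /andP[/andP[_ ->]].
have [g1 natg1 g1g] :=
  fill_horn downS cA loA vA yA lov nlov (d_le y yL) nvy faces nSv natg.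
set S1 := (fun B => _) in natg1.
(* With A and [A :\ d y] adjoined, all subsets of A are covered; hence S1 is again closed under
   subsets. *)
have subA (B : {set P}) : B \subset A -> S1 B.
  move=> BA; have [|none] := boolP [exists w in A, (w != d y) && (w \notin B)].
    case/exists_inP => w wA /andP[wv wB]; rewrite /S1 (downS B (A :\ w)) ?faces //.
    apply/subsetP => z zB; rewrite !inE (subsetP BA) // andbT.
    by apply: contraNneq wB => <-.
  have AvB : A :\ d y \subset B.
    apply/subsetP => z; rewrite !inE => /andP[zv zA]; apply: contraNT none => zB.
    by apply/exists_inP; exists z; rewrite ?zv.
  rewrite /S1; have [vB|vB] := boolP (d y \in B).
    by rewrite [B == A]eqEsubset BA -(setD1K vA) subUset sub1set vB AvB !orbT.
  rewrite [B == A :\ d y]eqEsubset AvB andbT.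
  suff -> : B \subset A :\ d y by rewrite !orbT.
  apply/subsetP => z zB; rewrite !inE (subsetP BA) // andbT.
  by apply: contraNneq vB => <-.
have downS1 : down_closed S1.
  move=> B D BD /or3P[SD|/eqP ED|/eqP ED]; first by rewrite /S1 (downS _ _ BD SD).
    by apply: subA; rewrite -ED.
  by apply/subA/(subset_trans BD); rewrite ED subsetDl.
have [] := IH S1 g1 downS1 _ _ natg1.
- rewrite -ltnS; apply: leq_trans ltN; rewrite ltnS; apply: proper_card.
  apply/properP; split.
    by apply/subsetP => B; rewrite !inE /S1 => /and3P[-> -> /norP[->]].
  by exists A => //; rewrite !inE /S1 eqxx orbT !andbF.
(* The pairing survives. If deleting [d z] from B gave A or [A :\ d y], then z = y; the first is
   absurd because [d y] is in A, and the second makes B one of the two sets just filled. *)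
- move=> B cB S'B; rewrite /S1 => /norP[nSB /norP[nBA nBAv]].
  have [exB hB] := gapS B cB S'B nSB; split=> // z lz.
  have [lo_z S'z nSz] := hB z lz; split=> //; rewrite (negbTE nSz) /=.
  have lzB : lowest L (B :\ d z) z.
    have [zB zL /forall_inP zmin] := and3P lz.
    apply/and3P; split=> //.
      by rewrite !inE zB andbT; apply: contraNneq (dL z) => <-.
    by apply/forall_inP => t; rewrite !inE => /andP[_]; exact: zmin.
  apply/norP; split.
    apply/eqP => eBA; rewrite eBA in lzB; have ezy := lowest_uniq lzB ly.
    by move: vA; rewrite -eBA ezy !inE eqxx.
  apply/eqP => eBA; rewrite eBA in lzB.
  have lyv : lowest L (A :\ d y) y.
    apply/and3P; split=> //; first by rewrite !inE eq_sym nvy.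
    by apply/forall_inP => t; rewrite !inE => /andP[_]; exact: ymin.
  have ezy := lowest_uniq lzB lyv; rewrite ezy in eBA.
  have [dyB|dyB] := boolP (d y \in B).
    by case/eqP: nBA; rewrite -(setD1K dyB) eBA setD1K.
  case/eqP: nBAv; rewrite -eBA; apply/setP => t; rewrite !inE.
  by case: eqVneq => // ->; rewrite (negbTE dyB).
- move=> g' natg' g'g1; exists g' => // n x Sx.
  by rewrite g'g1 ?g1g // /S1 Sx.
Qed.

End Filling.
End Chains.

Section Push.
Variables (P P' : finposet) (f : P -> P').
Hypothesis f_le : forall x y, ple x y -> ple (f x) (f y).

Definition push n (x : nerve (poset_cat P) n) : nerve (poset_cat P') n :=
  mkchain (fun i j ij => f_le (vtx_le x ij)).

Lemma verts_push n (x : nerve (poset_cat P) n) : verts (push x) = f @: verts x.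
Proof. by rewrite /verts -imset_comp. Qed.

Lemma push_res m n (a : mono m n) (x : nerve (poset_cat P) n) :
  push (res a x) = res a (push x).
Proof. exact: chain_eq. Qed.

End Push.

(** * Retracts of limit cones in a quasicategory *)

Section ConePoset.
Variables (m : nat) (P : finposet).

Definition cone_le (x y : 'I_m.+1 + P) : bool :=
  match x, y with
  | inl i, inl j => i <= j
  | inl _, inr _ => true
  | inr _, inl _ => false
  | inr p, inr q => ple p q
  end.

(** The ordinal sum of [m] and P; its nerve is the join of Delta^m with the nerve of P. *)
Definition cone_poset : finposet.
Proof.
exists ('I_m.+1 + P)%type cone_le.
- by case=> [i|p] /=; [exact: leqnn|exact: ple_refl].
- by case=> [i|p] [j|q] //= => [/anti_leq/val_inj->|/ple_anti->].
- by case=> [i|p] [j|q] [k|r] //=; [exact: leq_trans|exact: ple_trans].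
Defined.

Definition cone_inl (i : 'I_m.+1) : cone_poset := inl i.
Definition cone_inr (p : P) : cone_poset := inr p.

Lemma cone_inr_le (p q : P) : ple p q -> ple (cone_inr p) (cone_inr q).
Proof. by []. Qed.

(* The chains of [cone_poset m P] that miss a vertex of the standard simplex
   Delta^(m+1) spanned by the adjoined points and the bottom [bot] of P. *)
Definition bdry (bot : P) (S : {set cone_poset}) : bool :=
  ~~ ([forall i, cone_inl i \in S] && (cone_inr bot \in S)).

Lemma bdryS bot : down_closed (P := cone_poset) (bdry bot).
Proof.
move=> A B /subsetP AB; apply: contra => /andP[/forallP allA /AB->].
by rewrite andbT; apply/forallP => i; exact: AB.
Qed.

End ConePoset.

Arguments cone_inl {m P} i.
Arguments cone_inr {m P} p.

(* That the cone F over its restriction to the elements other than [bot] is a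
   limit, expressed by maps on chains instead of slices. *)
Definition has_fillers (P : finposet) (bot : P) (C : sset)
    (F : smap (nerve (poset_cat P)) C) : Prop :=
  forall m (g : forall n, nerve (poset_cat (cone_poset m P)) n -> C n),
  natural_on (bdry bot) g ->
  (forall n (y : nerve (poset_cat P) n), g n (push (@cone_inr_le m P) y) = sfun F y) ->
  exists2 g' : forall n, nerve (poset_cat (cone_poset m P)) n -> C n,
    natural_on predT g' &
    forall n (x : nerve (poset_cat (cone_poset m P)) n),
      bdry bot (verts x) -> g' n x = g n x.

(* The linear order Some false < None < Some true. In a retract diagram
   F -> G -> F, the two copies of F are at the levels [Some _] and G is at the level
   [None]. *)
Definition level_le (s t : option bool) : bool :=
  match s, t with
  | Some false, _ | _, Some true | None, None => true
  | _, _ => false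
  end.

(** Its nerve is the product of the nerve of P with Delta^2. *)
Definition prism (P : finposet) : finposet.
Proof.
exists (P * option bool)%type (fun x y => ple x.1 y.1 && level_le x.2 y.2).
- by case=> p [[]|] /=; rewrite ple_refl.
- move=> [p s] [q t] /= /andP[/andP[pq st] /andP[qp ts]].
  rewrite (@ple_anti P p q) ?pq //.
  by case: s t st ts => [[]|] [[]|].
- move=> [q t] [p s] [r u] /= /andP[pq st] /andP[qr tu].
  by rewrite (ple_trans pq qr); case: s t u st tu => [[]|] [[]|] [[]|].
Defined.

Definition at_level (P : finposet) (s : option bool) (p : P) : prism P := (p, s).

Lemma at_level_le (P : finposet) s (p q : P) :
  ple p q -> ple (at_level s p) (at_level s q).
Proof. by move=> /= ->; case: s => [[]|]. Qed.

Definition prism_base (P : finposet) (x : prism P) : P := x.1.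

Lemma prism_base_le (P : finposet) (x y : prism P) :
  ple x y -> ple (prism_base x) (prism_base y).
Proof. by case/andP. Qed.

Section Retract.
Variables (P : finposet) (bot : P).
Hypothesis bot_le : forall p, ple bot p.
Variables (C : sset) (quasiC : quasicategory C).
Variables (F G : smap (nerve (poset_cat P)) C).
Variable H : smap (nerve (poset_cat (prism P))) C.
(** On the two outer levels H does not depend on the level. This encodes that the composite F -> G
    -> F is the identity. *)
Hypothesis H_ends : forall n (x : nerve (poset_cat (prism P)) n),
  (forall i, (vtx x i).2 != None) -> sfun H x = sfun F (push (@prism_base_le P) x).
Hypothesis H_mid : forall n (y : nerve (poset_cat P) n),
  sfun H (push (@at_level_le P None) y) = sfun G y.
Hypothesis fillG : has_fillers bot G.

Section Fill.
Variable m : nat.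
Let B := cone_poset m P.
Let Q := cone_poset m (prism P).

Let flat (x : Q) : B :=
  match x with inl i => inl i | inr y => inr y.1 end.
Let lift_at (s : option bool) (x : B) : Q :=
  match x with inl i => inl i | inr p => inr (p, s) end.
(** The value on adjoined points is a default that keeps the map monotone; only chains without
    adjoined points matter. *)
Let to_prism (x : Q) : prism P :=
  match x with inl i => (bot, Some false) | inr y => y end.

Let flat_le x y : ple x y -> ple (flat x) (flat y).
Proof. by case: x y => [i|[p s]] [j|[q t]] //= /andP[]. Qed.

Let lift_le s x y : ple x y -> ple (lift_at s x) (lift_at s y).
Proof. by case: x y => [i|p] [j|q] //= ->; case: s => [[]|]. Qed.

Let to_prism_le x y : ple x y -> ple (to_prism x) (to_prism y).
Proof. by case: x y => [i|[p s]] [j|[q t]] //= _; rewrite ?ple_refl ?bot_le. Qed.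

Let is_a (x : Q) : bool := if x is inl _ then true else false.
Let lev (s : option bool) (x : Q) : bool := if x is inr y then y.2 == s else false.

Let bdryQ (S : {set Q}) : bool := bdry bot (flat @: S).

Let bdryQS : down_closed bdryQ.
Proof. by move=> S S' SS'; apply: bdryS; exact: imsetS. Qed.

Let none_of (p : pred Q) (S : {set Q}) := [forall x in S, ~~ p x].

Let none_ofS p : down_closed (none_of p).
Proof.
move=> S S' /subsetP SS' /forall_inP h; apply/forall_inP => x /SS'; exact: h.
Qed.

Let none_ofP p n (x : nerve (poset_cat Q) n) :
  reflect (forall i, ~~ p (vtx x i)) (none_of p (verts x)).
Proof.
apply: (iffP forall_inP) => h; first by move=> i; apply/h/vtx_in.
by move=> _ /imsetP[i _ ->]; exact: h.
Qed.

Let bdryQ_flat n (x : nerve (poset_cat Q) n) :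
  bdryQ (verts x) = bdry bot (verts (push flat_le x)).
Proof. by rewrite verts_push. Qed.

Let flat_lift s n (x : nerve (poset_cat B) n) : push flat_le (push (@lift_le s) x) = x.
Proof. by apply: chain_eq => i; rewrite /vtx /= -/(vtx x i); case: (vtx x i). Qed.

Let lift_flat s n (x : nerve (poset_cat Q) n) :
  (forall i, is_a (vtx x i) || lev s (vtx x i)) -> push (@lift_le s) (push flat_le x) = x.
Proof.
move=> h; apply: chain_eq => i; have := h i; rewrite /vtx /= -/(vtx x i).
by case: (vtx x i) => [|[p t]] //= /eqP->.
Qed.

Let bdryQ_lift s n (x : nerve (poset_cat B) n) :
  bdryQ (verts (push (@lift_le s) x)) = bdry bot (verts x).
Proof. by rewrite bdryQ_flat flat_lift. Qed.

Variable g : forall n, nerve (poset_cat B) n -> C n.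
Hypothesis natg : natural_on (bdry bot) g.
Hypothesis gF : forall n (y : nerve (poset_cat P) n),
  g (push (@cone_inr_le m P) y) = sfun F y.

Let bdryQ_add (A : {set Q}) p s t :
  (inr (p, s) : Q) \in A -> bdryQ A -> bdryQ ((inr (p, t) : Q) |: A).
Proof.
move=> ysA; rewrite /bdryQ imsetU1.
suff -> : flat (inr (p, t)) |: flat @: A = flat @: A by [].
by apply/setUidPr; rewrite sub1set; apply/imsetP; exists (inr (p, s)).
Qed.

Let bdryQ_del (A : {set Q}) p s t : s != t ->
  (inr (p, s) : Q) \in A -> bdryQ (A :\ (inr (p, t) : Q)) -> bdryQ A.
Proof.
move=> nst ysA; rewrite /bdryQ.
suff -> : flat @: (A :\ (inr (p, t) : Q)) = flat @: A by [].
apply/eqP; rewrite eqEsubset imsetS ?subsetDl //=; apply/subsetP => _ /imsetP[x xA ->].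
have [->|nx] := eqVneq x (inr (p, t) : Q); last by apply: imset_f; rewrite !inE nx.
apply/imsetP; exists (inr (p, s)) => //; rewrite !inE ysA andbT.
by apply: contra nst => /eqP[->].
Qed.

(** The part known at first: boundary chains that either stay in the prism, where H prescribes the
    value, or avoid the middle level, where g is copied to both outer levels. *)
Let S0 (S : {set Q}) := bdryQ S && (none_of is_a S || none_of (lev None) S).
Let g0 n (x : nerve (poset_cat Q) n) : C n :=
  if none_of is_a (verts x) then sfun H (push to_prism_le x)
  else g (push flat_le x).

(** On the overlap both prescriptions reduce to F, by [gF] and [H_ends]. *)
Let g0F n (x : nerve (poset_cat Q) n) :
  none_of is_a (verts x) -> none_of (lev None) (verts x) ->
  g (push flat_le x) = sfun H (push to_prism_le x).
Proof.
move=> /none_ofP noa /none_ofP noN; rewrite H_ends.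
  rewrite -gF; congr (g _); apply: chain_eq => i.
  have := noa i; rewrite /vtx /= -!/(vtx x i).
  by case: (vtx x i).
move=> i; have := noN i; have := noa i; rewrite /vtx /= -!/(vtx x i).
by case: (vtx x i).
Qed.

Let natg0 : natural_on S0 g0.
Proof.
move=> m' n f x /andP[bx /orP[noa|noN]]; rewrite /g0.
  by rewrite noa (none_ofS (verts_res f x)) // push_res sfun_res.
have [noa|_] := boolP (none_of is_a (verts x)).
  by rewrite (none_ofS (verts_res f x)) // push_res sfun_res.
have ng : res f (g (push flat_le x)) = g (push flat_le (res f x)).
  by rewrite push_res natg // -bdryQ_flat.
rewrite ng; have [noa'|//] := boolP (none_of is_a _).
by rewrite g0F // (none_ofS (verts_res f x)).
Qed.

Let S0_down : down_closed S0.
Proof.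
move=> S S' SS' /andP[b h]; rewrite /S0 (bdryQS SS' b) /=.
by case/orP: h => /(none_ofS SS')->; rewrite ?orbT.
Qed.

Let lower (s t : option bool) (x : Q) : Q :=
  match x with inl i => inl i | inr y => inr (y.1, if y.2 == s then t else y.2) end.

Let lower_le s t y : level_le t s -> lev s y -> ple (lower s t y) y.
Proof. by case: y => [//|[p u]] /= ts /eqP->; rewrite eqxx ple_refl. Qed.

Let lower_lev s t y : t != s -> ~~ lev s (lower s t y).
Proof. by case: y => [//|[p u]] nts /=; case: (eqVneq u s). Qed.

Let lower_max s t (y z : Q) : (forall u, level_le u s -> u != s -> level_le u t) ->
  lev s y -> ~~ lev s z -> ple z y -> ple z (lower s t y).
Proof.
move=> ts; case: y z => [//|[p u]] [//|[q u']] /= /eqP-> nu' /andP[-> us].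
by rewrite eqxx; exact: ts.
Qed.

Let has_none_of (p : pred Q) (A : {set Q}) : ~~ none_of p A -> exists2 x, x \in A & p x.
Proof.
by rewrite negb_forall_in => /exists_inP[x xA]; rewrite negbK; exists x.
Qed.

Let none_ofN (p : pred Q) (A : {set Q}) x : x \in A -> p x -> ~~ none_of p A.
Proof. by move=> xA px; apply/negP => /forall_inP/(_ x xA); rewrite px. Qed.

(** A missing chain contains an adjoined point and a vertex at level [None]. The lowest such vertex
    is paired with its copy at level [Some false]; the adjoined point lies below this copy, so the
    horns are inner. *)
Let fill_mid : exists2 g1 : forall n, nerve (poset_cat Q) n -> C n,
  natural_on bdryQ g1 &
  forall n (x : nerve (poset_cat Q) n), S0 (verts x) -> g1 n x = g0 x.
Proof.
apply: (@extend_down Q C quasiC [pred x | lev None x] (lower None (Some false)) S0).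
- by move=> y; exact: lower_le.
- by move=> y; exact: lower_lev.
- by move=> y z; apply: lower_max => -[[]|].
- exact: S0_down.
- exact: bdryQS.
- move=> A _ bA; rewrite /S0 bA /= => /norP[/has_none_of[a aA isa] /has_none_of[y yA yN]].
  split; first by exists y.
  move=> z /and3P[zA zN _].
  case: a isa aA => [i _ iA|//]; split.
  + by exists (inl i) => //; case: z {zA} zN => [|[p u]].
  + case: z zA zN => [//|[p u]] /= zA /eqP/= uN.
    by rewrite uN eqxx in zA *; apply: bdryQ_add zA bA.
  + rewrite negb_and negb_or; apply/orP; right; apply/andP; split.
      apply: (@none_ofN _ _ (inl i)) => //; rewrite !inE iA andbT.
      by case: z {zA} zN => [|[p u]].
    apply: (@none_ofN _ _ z) => //; rewrite !inE zA andbT.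
    by apply: contraTneq zN => ->; exact: lower_lev.
- exact: natg0.
Qed.

(** The second extension starts from the chains over the two upper levels that avoid level
    [Some true], filled by means of G, and from the boundary chains, filled by the first
    extension. *)
Let S2 (S : {set Q}) :=
  none_of (lev (Some false)) S && (none_of (lev (Some true)) S || bdryQ S).

Lemma fill_retract : exists2 g' : forall n, nerve (poset_cat B) n -> C n,
  natural_on predT g' &
  forall n (x : nerve (poset_cat B) n), bdry bot (verts x) -> g' n x = g x.
Proof.
have [g1 natg1 g1g0] := fill_mid.
(* The middle level of [g1] poses a boundary problem for G. *)
have [|n y|g3 natg3 g3g1] := @fillG m (fun n x => g1 n (push (@lift_le None) x)).
- move=> n k f x bx; rewrite push_res; apply: natg1.
  by rewrite bdryQ_lift.
- have noa : none_of is_a (verts (push (@lift_le None) (push (@cone_inr_le m P) y))).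
    exact/none_ofP.
  rewrite g1g0 /g0 ?noa; last first.
    rewrite /S0 noa andbT bdryQ_lift /bdry; apply/negP => /andP[/forallP/(_ ord0)].
    by case/imsetP.
  by rewrite -H_mid; congr (sfun H _); exact: chain_eq.
pose g2 n (x : nerve (poset_cat Q) n) : C n :=
  if none_of (lev (Some true)) (verts x) then g3 n (push flat_le x) else g1 n x.
have natg2 : natural_on S2 g2.
  move=> n k f x /andP[no0 Sx]; rewrite /g2.
  have [no1|yes1] := boolP (none_of _ (verts x)).
    by rewrite (none_ofS (verts_res f x)) // push_res natg3.
  rewrite (negbTE yes1) /= in Sx; rewrite -natg1 //.
  have [no1|//] := boolP (none_of _ _).
  rewrite g3g1; last by rewrite -bdryQ_flat (bdryQS (verts_res f x)).
  rewrite lift_flat // => i.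
  have /none_ofP/(_ i) := none_ofS (verts_res f x) no0.
  have /none_ofP/(_ i) := no1.
  by case: (vtx _ i) => [|[p [[]|]]].
have S2_down : down_closed S2.
  move=> S S' SS' /andP[h0 h1]; rewrite /S2 (none_ofS SS') //=.
  by case/orP: h1 => [/(none_ofS SS')->|/(bdryQS SS')->]; rewrite ?orbT.
(* A missing chain projects outside the boundary, so it contains all adjoined points; they lie below
   the lowered vertex and make the horns inner. *)
have [] := @extend_down Q C quasiC [pred x | lev (Some true) x]
  (lower (Some true) None) S2 (none_of (lev (Some false))) g2 _ _ _ S2_down _ _ natg2.
- by move=> y; exact: lower_le.
- by move=> y; exact: lower_lev.
- by move=> y z; apply: lower_max => -[[]|].
- exact: none_ofS.
- move=> A _ no0; rewrite /S2 no0 /= => /norP[/has_none_of[y yA y1] nbA].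
  split; first by exists y.
  have aA : (inl ord0 : Q) \in A.
    move: nbA; rewrite negbK => /andP[/forallP/(_ ord0)/imsetP[[i|//] iA [->]] _].
    by [].
  move=> z /and3P[zA z1 _]; split.
  + by exists (inl ord0) => //; case: z {zA} z1.
  + apply/forall_inP => t; rewrite !inE => /orP[/eqP->|tA]; last exact: (forall_inP no0).
    by case: z {zA} z1 => [//|[p u]] /= /eqP/=->.
  + rewrite negb_and negb_or; apply/orP; right; apply/andP; split.
      apply: (@none_ofN _ _ z) => //; rewrite !inE zA andbT.
      by apply: contraTneq z1 => ->; exact: lower_lev.
    apply: contra nbA; case: z zA z1 => [//|[p u]] zA /= /eqP/= h.
    by rewrite h eqxx in zA *; apply: bdryQ_del zA.
move=> g4 natg4 g4g2.
exists (fun n x => g4 n (push (@lift_le (Some true)) x)).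
  move=> n k f x _; rewrite push_res; apply: natg4; apply/none_ofP => i.
  by rewrite /vtx /= -/(vtx x i); case: (vtx x i).
move=> n x bx.
have no0 : none_of (lev (Some false)) (verts (push (@lift_le (Some true)) x)).
  by apply/none_ofP => i; rewrite /vtx /= -/(vtx x i); case: (vtx x i).
rewrite g4g2; last by rewrite /S2 no0 bdryQ_lift bx orbT.
(* If x has no vertex in P, its lift avoids level [Some true] and the value passes through [g3];
   otherwise it comes from [g1] directly. *)
rewrite /g2; case: ifP => [no1|yes1].
  rewrite flat_lift g3g1 // g1g0; last first.
    rewrite /S0 bdryQ_lift bx; apply/orP; right; apply/none_ofP => i.
    have /none_ofP/(_ i) := no1; rewrite /vtx /= -!/(vtx x i).
    by case: (vtx x i).
  have noN : none_of (lev None) (verts (push (@lift_le None) x)).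
    apply/none_ofP => i.
    have /none_ofP/(_ i) := no1; rewrite /vtx /= -!/(vtx x i).
    by case: (vtx x i).
  by rewrite /g0; case: ifP => noa; rewrite -?g0F // flat_lift.
have noN : none_of (lev None) (verts (push (@lift_le (Some true)) x)).
  apply/none_ofP => i; rewrite /vtx /= -!/(vtx x i).
  by case: (vtx x i).
rewrite g1g0; last by rewrite /S0 bdryQ_lift bx noN orbT.
by rewrite /g0; case: ifP => noa; rewrite -?g0F // flat_lift.
Qed.

End Fill.

Lemma has_fillers_retract : has_fillers bot F.
Proof. by move=> m g natg gF; exact: fill_retract natg gF. Qed.

End Retract.

(** * Slices and chains *)

Definition const_mono m n (j : 'I_n.+1) : mono m n :=
  @Mono m n (fun _ => j) (fun _ _ _ => leqnn j).

Section JoinParts.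
Variables n1 n2 : nat.

(** Retractions of the ordinal sum onto its two summands; the defaults are the only ones that make
    them monotone. *)
Definition lpart (k : 'I_(n1.+1 + n2.+1)) : 'I_n1.+1 :=
  if split k is inl a then a else ord_max.
Definition rpart (k : 'I_(n1.+1 + n2.+1)) : 'I_n2.+1 :=
  if split k is inr b then b else ord0.

Lemma lpart_mono_homo (j k : 'I_(n1.+1 + n2.+1)) : j <= k -> lpart j <= lpart k.
Proof.
rewrite /lpart; case: (splitP j) => a ea; case: (splitP k) => b eb jk.
- by rewrite -ea -eb.
- by rewrite -ltnS ltn_ord.
- have : n1.+1 + a < n1.+1 by rewrite -ea (leq_ltn_trans jk) // eb.
  by rewrite ltnNge leq_addr.
- by [].
Qed.

Lemma rpart_mono_homo (j k : 'I_(n1.+1 + n2.+1)) : j <= k -> rpart j <= rpart k.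
Proof.
rewrite /rpart; case: (splitP j) => a ea; case: (splitP k) => b eb jk //.
  have : n1.+1 + a < n1.+1 by rewrite -ea (leq_ltn_trans jk) // eb.
  by rewrite ltnNge leq_addr.
by rewrite -(leq_add2l n1.+1) -ea -eb.
Qed.

Definition lpart_mono : mono (n1 + n2.+1) n1 := Mono lpart_mono_homo.
Definition rpart_mono : mono (n1 + n2.+1) n2 := Mono rpart_mono_homo.

Lemma lpartK (k : 'I_(n1.+1 + n2.+1)) : k < n1.+1 -> lshift n2.+1 (lpart k) = k.
Proof. by rewrite /lpart; case: (splitP k) => a ea // _; exact: val_inj. Qed.

Lemma rpartK (k : 'I_(n1.+1 + n2.+1)) : n1 < k -> rshift n1.+1 (rpart k) = k.
Proof.
by rewrite /rpart leqNgt; case: (splitP k) => a ea // _; exact: val_inj.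
Qed.

End JoinParts.

Lemma sub_set_anti (T : finType) (p : pred {set T}) :
  antisymmetric (fun J J' : {J : {set T} | p J} => sval J \subset sval J').
Proof. by move=> J J' JJ'; apply/val_inj/eqP; rewrite eqEsubset. Qed.

Definition powerset_poset (T : finType) (I : {set T}) : finposet :=
  @FinPoset {J : {set T} | J \subset I} (fun J J' => sval J \subset sval J')
    (fun J : {J : {set T} | J \subset I} => subxx (sval J)) (@sub_set_anti T _)
    (fun J' J J'' : {J : {set T} | J \subset I} =>
       @subset_trans _ (sval J) (sval J') (sval J'')).

Definition nonempty_poset (T : finType) (I : {set T}) : finposet :=
  @FinPoset {J : {set T} | (J \subset I) && (J != set0)}
    (fun J J' => sval J \subset sval J')
    (fun J : {J : {set T} | (J \subset I) && (J != set0)} => subxx (sval J))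
    (@sub_set_anti T _)
    (fun J' J J'' : {J : {set T} | (J \subset I) && (J != set0)} =>
       @subset_trans _ (sval J) (sval J') (sval J'')).

Section SliceFillers.
Variables (T : finType) (I : {set T}) (I0 : I != set0) (C : sset).
Variable F : smap (nerve (powerset_cat I)) C.

Let P := powerset_poset I.
Let K := nonempty_poset I.
Let bot : P := empty_vertex I.
Let p : smap (nerve (nonempty_powerset_cat I)) C := scomp F (nerve_map (nonempty_incl I)).
Let incl (J : K) : P := nonempty_incl I J.
Let incl_le (J J' : K) : ple J J' -> ple (incl J) (incl J').
Proof. by []. Qed.

Section Join.
Variable m : nat.
Let B := cone_poset m P.

(* [on_simplex] holds on the vertices of the simplex Delta^(m+1) whose last
   vertex is the bottom of P, and [vert], [unvert] identify them. *)
Let on_simplex (t : B) : bool := if t is inr J then sval J == set0 else true.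
Let vert (j : 'I_m.+2) : B :=
  if (j <= m)%N then inl (inord j) else inr bot.
Let unvert (t : B) : 'I_m.+2 := if t is inl i then inord i else ord_max.
(** An element of K, available because I is nonempty; it serves as the default value of [toK]. *)
Let top : {J : {set T} | (J \subset I) && (J != set0)} :=
  exist _ I (introT andP (conj (subxx I) I0)).
Let toK (t : B) : K := if t is inr J then insubd top (sval J) else top.

Let vert_le (i j : 'I_m.+2) : i <= j -> ple (vert i) (vert j).
Proof.
move=> ij; rewrite /vert; case: (leqP i m) => im; case: (leqP j m) => jm //=.
- by rewrite !inordK.
- by have := leq_trans im (leq_trans ij jm); rewrite ltnn.
Qed.

Let val_inl (i : 'I_m.+1) : unvert (inl i) = i :> nat.
Proof. by rewrite inordK // ltnS ltnW. Qed.

Let unvert_le (s t : B) : ple s t -> unvert s <= unvert t.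
Proof.
case: s t => [i|J] [j|J'] //=; rewrite ?val_inl // => _.
exact: ltnW (ltn_ord i).
Qed.

Let vertK j : unvert (vert j) = j.
Proof.
apply: ord_inj; rewrite /vert; case: (leqP j m) => jm; first by rewrite val_inl inordK.
by apply/anti_leq; rewrite jm -ltnS ltn_ord.
Qed.

Let unvertK t : on_simplex t -> vert (unvert t) = t.
Proof.
rewrite /vert; case: t => [i _|J /= /eqP J0].
  by rewrite val_inl -ltnS ltn_ord; congr inl; exact: inord_val.
by rewrite ltnn; congr inr; apply: val_inj.
Qed.

Let on_simplex_vert j : on_simplex (vert j).
Proof. by rewrite /vert; case: (leqP j m) => //= _; rewrite eqxx. Qed.

Let toKK t : ~~ on_simplex t -> inr (incl (toK t)) = t.
Proof.
case: t => [//|J] /= J0; congr inr; apply: val_inj; rewrite /= -/(val _).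
by rewrite val_insubd J0 (svalP J).
Qed.

Let toK_incl (J : K) : toK (inr (incl J)) = J.
Proof. by apply: val_inj; rewrite val_insubd (svalP J). Qed.

Let on_simplex_incl (J : K) : on_simplex (inr (incl J)) = false.
Proof. by apply/negbTE; case/andP: (svalP J). Qed.

Let on_simplex_le s t : ple s t -> on_simplex t -> on_simplex s.
Proof.
case: s t => [i|J] [j|J'] //= JJ' /eqP J0; by rewrite -subset0 -J0.
Qed.

(** Since [bot] lies below all of P, [m] followed by P is also [m+1] followed by K, with [bot] as
    the last vertex of the simplex. These chains thus exhibit the nerve of [cone_poset m P] as the
    join of Delta^(m+1) with the nerve of K. *)
Definition join_fun_chain n1 n2 (a : mono n1 m.+1) (x : nerve (poset_cat K) n2)
    (k : 'I_(n1.+1 + n2.+1)) : B :=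
  match split k with
  | inl i => vert (a i)
  | inr j => inr (incl (vtx x j))
  end.

Lemma join_fun_chain_le n1 n2 (a : mono n1 m.+1) (x : nerve (poset_cat K) n2)
    (j k : 'I_(n1.+1 + n2.+1)) :
  j <= k -> ple (join_fun_chain a x j) (join_fun_chain a x k).
Proof.
move=> jk; rewrite /join_fun_chain; case: (splitP j) => i ei; case: (splitP k) => l el.
- by apply/vert_le/mono_homo; rewrite -ei -el.
- by rewrite /vert; case: ifP => //= _; exact: sub0set.
- have : n1.+1 + i < n1.+1 by rewrite -ei (leq_ltn_trans jk) // el.
  by rewrite ltnNge leq_addr.
- by apply: (vtx_le x); rewrite -(leq_add2l n1.+1) -ei -el.
Qed.

Definition join_chain n1 n2 (a : mono n1 m.+1) (x : nerve (poset_cat K) n2) :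
  nerve (poset_cat B) (n1 + n2.+1) := mkchain (join_fun_chain_le a x).

Definition simplex_chain n (a : mono n m.+1) : nerve (poset_cat B) n :=
  mkchain (fun i j ij => vert_le (mono_homo a ij)).

Lemma join_chain_l n1 n2 (a : mono n1 m.+1) (x : nerve (poset_cat K) n2) i :
  join_fun_chain a x (lshift n2.+1 i) = vert (a i).
Proof. by rewrite /join_fun_chain (unsplitK (inl i : 'I_n1.+1 + 'I_n2.+1)). Qed.

Lemma join_chain_r n1 n2 (a : mono n1 m.+1) (x : nerve (poset_cat K) n2) i :
  join_fun_chain a x (rshift n1.+1 i) = inr (incl (vtx x i)).
Proof. by rewrite /join_fun_chain (unsplitK (inr i : 'I_n1.+1 + 'I_n2.+1)). Qed.

Lemma join_chain_inl n1 n2 (a : mono n1 m.+1) (x : nerve (poset_cat K) n2) :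
  res (inl_mono n1 n2) (join_chain a x) = simplex_chain a.
Proof. by apply: chain_eq => i; exact: join_chain_l. Qed.

Lemma join_chain_inr n1 n2 (a : mono n1 m.+1) (x : nerve (poset_cat K) n2) :
  res (inr_mono n1 n2) (join_chain a x) = push (@cone_inr_le m P) (push incl_le x).
Proof. by apply: chain_eq => i; exact: join_chain_r. Qed.

Lemma join_chain_res n1 n2 n1' n2' (f : mono n1' n1) (h : mono n2' n2)
    (a : mono n1 m.+1) (x : nerve (poset_cat K) n2) :
  res (join_mono f h) (join_chain a x) = join_chain (mono_comp a f) (res h x).
Proof.
apply: chain_eq => i; rewrite /vtx /= {2}/join_fun_chain /join_fun.
case: (splitP (m := n1'.+1) (n := n2'.+1) i) => j _.
- by rewrite join_chain_l.
- by rewrite join_chain_r.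
Qed.

Let on_simplex_join n1 n2 (a : mono n1 m.+1) (x : nerve (poset_cat K) n2) 
    (k : 'I_(n1.+1 + n2.+1)) : on_simplex (join_fun_chain a x k) = (k < n1.+1).
Proof.
case: (ltnP k n1.+1) => kn.
  by rewrite -(lpartK kn) join_chain_l on_simplex_vert.
by rewrite -(rpartK kn) join_chain_r on_simplex_incl.
Qed.

(* Every chain y of [cone_poset m P] is the image under a map [dec y] of the join
   of a simplex [dec_l y] of Delta^(m+1) and a chain [dec_r y] of K. Both have the
   dimension of y, which avoids casts along n1 + n2.+1 = n; the vertices of the
   joined chains that [dec y] misses are irrelevant by [dec_value]. *)
Section Decomposition.
Variables (n : nat) (y : nerve (poset_cat B) n).

Let cut := find (fun i => ~~ on_simplex (vtx y (inord i))) (iota 0 n.+1).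

Let cutP (i : 'I_n.+1) : on_simplex (vtx y i) = (i < cut).
Proof.
have sz : size (iota 0 n.+1) = n.+1 by rewrite size_iota.
case: (ltnP i cut) => ic.
  have := before_find 0 ic; rewrite nth_iota // add0n inord_val => /negbT.
  by rewrite negbK.
have cn : cut < n.+1 by rewrite (leq_ltn_trans ic).
have : has (fun i => ~~ on_simplex (vtx y (inord i))) (iota 0 n.+1).
  by rewrite has_find sz.
move/(nth_find 0); rewrite -/cut nth_iota // add0n => nc.
apply/negbTE; apply: contra nc; apply: on_simplex_le; apply: vtx_le.
by rewrite inordK.
Qed.

(** Indices are clamped to the vertices on the simplex and to those off it, respectively. If there
    are none of that kind, the map is constant, at 0 or at n. *)
Let lo_fun (i : 'I_n.+1) : 'I_n.+1 := inord (minn i cut.-1).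
Let hi_fun (i : 'I_n.+1) : 'I_n.+1 := inord (minn (maxn i cut) n).

Let val_lo i : lo_fun i = minn i cut.-1 :> nat.
Proof. by rewrite inordK // (leq_ltn_trans (geq_minl _ _)). Qed.

Let val_hi i : hi_fun i = minn (maxn i cut) n :> nat.
Proof. by rewrite inordK // ltnS geq_minr. Qed.

Let lo_homo (i j : 'I_n.+1) : i <= j -> lo_fun i <= lo_fun j.
Proof. by move=> ij; rewrite !val_lo leq_min geq_minr (leq_trans (geq_minl _ _)). Qed.

Let hi_homo (i j : 'I_n.+1) : i <= j -> hi_fun i <= hi_fun j.
Proof.
move=> ij; rewrite !val_hi leq_min geq_minr andbT geq_min.
by apply/orP; left; rewrite geq_max !leq_max ij leqnn orbT.
Qed.

Let lo : mono n n := Mono lo_homo.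
Let hi : mono n n := Mono hi_homo.

Definition dec_l : mono n m.+1 :=
  Mono (fun i j ij => unvert_le (vtx_le y (lo_homo ij))).

Lemma dec_r_le (i j : 'I_n.+1) : i <= j -> ple (toK (vtx y (hi i))) (toK (vtx y (hi j))).
Proof.
move=> ij; case: (leqP cut n) => cn.
  have nhi k : ~~ on_simplex (vtx y (hi k)).
    rewrite cutP -leqNgt /= val_hi leq_min cn andbT leq_max leqnn orbT //.
  have := vtx_le y (hi_homo ij).
  rewrite -{1}(toKK (nhi i)) -{1}(toKK (nhi j)).
  by [].
have -> : hi i = hi j.
  apply: val_inj; rewrite /= !val_hi !(minn_idPr _) //.
    by rewrite leq_max (ltnW cn) orbT.
  by rewrite leq_max (ltnW cn) orbT.
exact: ple_refl.
Qed.

Definition dec_r : nerve (poset_cat K) n := mkchain dec_r_le.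

Definition dec_fun (i : 'I_n.+1) : 'I_(n.+1 + n.+1) :=
  if on_simplex (vtx y i) then lshift n.+1 i else rshift n.+1 i.

Lemma dec_homo (i j : 'I_n.+1) : i <= j -> dec_fun i <= dec_fun j.
Proof.
move=> ij; rewrite /dec_fun !cutP.
case: (ltnP i cut) => ic; case: (ltnP j cut) => jc //=.
- by rewrite (leq_trans (ltnW (ltn_ord i))) // leq_addr.
- by have := leq_trans jc (leq_trans ic ij); rewrite ltnn.
- by rewrite leq_add2l.
Qed.

Definition dec : mono n (n + n.+1) := Mono dec_homo.

Let lo_id i : on_simplex (vtx y i) -> lo_fun i = i.
Proof.
rewrite cutP => ic; apply: ord_inj; rewrite val_lo (minn_idPl _) //.
by case: cut ic.
Qed.

Let hi_id i : ~~ on_simplex (vtx y i) -> hi_fun i = i.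
Proof.
rewrite cutP -leqNgt => ic; apply: ord_inj; rewrite val_hi (maxn_idPl _) //.
by rewrite (minn_idPl _) // -ltnS.
Qed.

Lemma decE : res dec (join_chain dec_l dec_r) = y.
Proof.
apply: chain_eq => i; rewrite /vtx /= -/(vtx y i) /dec_fun.
case: ifP => [h|/negbT h].
  by rewrite join_chain_l /= unvertK lo_id.
by rewrite join_chain_r /= /vtx /= -/(vtx y _) hi_id // toKK.
Qed.

Lemma dec_l_max : ~~ on_simplex (vtx y ord0) -> forall i, dec_l i = ord_max.
Proof.
rewrite cutP -leqNgt leqn0 => /eqP c0 i /=.
have : ~~ on_simplex (vtx y (lo_fun i)) by rewrite cutP c0.
by case: (vtx y _).
Qed.

Lemma dec_l_vtx : on_simplex (vtx y ord0) -> forall i, vert (dec_l i) \in verts y.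
Proof.
rewrite cutP => c0 i; rewrite unvertK ?vtx_in // cutP val_lo.
by rewrite gtn_min; apply/orP; right; case: cut c0.
Qed.

(** The value does not depend on how y is presented as a restriction of a join. If y stays on one
    side, both presentations factor through that summand, and [sl_inl] or [sl_inr] applies.
    Otherwise u and w carry the presentation (a, x) to ([dec_l], [dec_r]), and naturality of the
    slices in both variables applies. *)
Lemma dec_value (A : forall k, mono k m.+1 -> Prop)
    (b : forall k, mono k m.+1 -> slice p k) :
  (forall k k' (f : mono k' k) (a : mono k m.+1), A k a ->
    b k' (mono_comp a f) = res f (b k a)) ->
  forall n1 n2 (a : mono n1 m.+1) (x : nerve (poset_cat K) n2)
    (j : mono n (n1 + n2.+1)),
  A n1 a -> res j (join_chain a x) = y ->
  res dec (sl_join (b n dec_l) dec_r) = res j (sl_join (b n1 a) x).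
Proof.
move=> natb n1 n2 a x j Aa ey.
have on_j i : on_simplex (vtx y i) = (j i < n1.+1).
  by rewrite -ey -(on_simplex_join a x).
pose u := mono_comp (lpart_mono n1 n2) (mono_comp j lo).
pose w := mono_comp (rpart_mono n1 n2) (mono_comp j hi).
have vtx_on i : on_simplex (vtx y i) -> vtx y i = vert (a (lpart (j i))).
  rewrite on_j => h; rewrite -[in LHS]ey -[LHS]/(join_fun_chain a x (j i)).
  by rewrite -{1}(lpartK h) join_chain_l.
have vtx_off i : ~~ on_simplex (vtx y i) ->
    vtx y i = inr (incl (vtx x (rpart (j i)))).
  rewrite on_j -leqNgt => h; rewrite -[in LHS]ey -[LHS]/(join_fun_chain a x (j i)).
  by rewrite -{1}(rpartK h) join_chain_r.
have vtx_lo i : on_simplex (vtx y (lo i)) -> dec_l i = a (u i).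
  by move=> h; rewrite -[LHS]/(unvert (vtx y (lo i))) vtx_on // vertK.
have vtx_hi i : ~~ on_simplex (vtx y (hi i)) -> vtx dec_r i = vtx x (w i).
  by move=> h; rewrite -[LHS]/(toK (vtx y (hi i))) vtx_off // toK_incl.
have [all_on|some_off] := boolP [forall i, on_simplex (vtx y i)].
  have all_on' i : on_simplex (vtx y i) by exact: (forallP all_on).
  have -> : dec = inl_mono n n.
    by apply: mono_eq => i; rewrite /= /dec_fun all_on'.
  have -> : j = mono_comp (inl_mono n1 n2) u.
    by apply: mono_eq => i; rewrite /= lo_id // lpartK // -on_j.
  rewrite res_comp !sl_inl.
  have -> : dec_l = mono_comp a u by apply: mono_eq => i; exact: vtx_lo.
  by rewrite natb.
have [all_off|some_on] := boolP [forall i, ~~ on_simplex (vtx y i)].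
  have all_off' i : ~~ on_simplex (vtx y i) by exact: (forallP all_off).
  have -> : dec = inr_mono n n.
    by apply: mono_eq => i; rewrite /= /dec_fun (negbTE (all_off' i)).
  have -> : j = mono_comp (inr_mono n1 n2) w.
    apply: mono_eq => i; rewrite /= hi_id // rpartK //.
    by rewrite ltnNge -ltnS -on_j.
  rewrite res_comp !sl_inr -sfun_res; congr (sfun p _).
  by apply: (@chain_eq K) => i; exact: vtx_hi.
have cut_pos : 0 < cut.
  move: some_on; rewrite negb_forall => /existsP[i]; rewrite negbK cutP.
  exact: leq_ltn_trans.
have cut_le : cut <= n.
  move: some_off; rewrite negb_forall => /existsP[i]; rewrite cutP -leqNgt => ci.
  by rewrite (leq_trans ci) // -ltnS.
have -> : dec_l = mono_comp a u.
  apply: mono_eq => i; apply: vtx_lo; rewrite cutP /= val_lo gtn_min.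
  by apply/orP; right; rewrite prednK.
have -> : dec_r = res w x.
  apply: (@chain_eq K) => i; apply: vtx_hi; rewrite cutP /= val_hi -leqNgt leq_min cut_le.
  by rewrite leq_max leqnn orbT.
rewrite natb // sl_nat /= -!res_comp.
congr (res _ _); apply: mono_eq => i; rewrite /= /dec_fun.
case: ifP => [h|/negbT h]; rewrite /join_fun.
  rewrite (unsplitK (inl i : 'I_n.+1 + 'I_n.+1)).
  rewrite (unsplitK (inl _ : 'I_n.+1 + 'I_n2.+1)) /= lo_id //.
  by rewrite lpartK // -on_j.
rewrite (unsplitK (inr i : 'I_n.+1 + 'I_n.+1)).
rewrite (unsplitK (inr _ : 'I_n.+1 + 'I_n2.+1)) /= hi_id //.
by rewrite rpartK // ltnNge -ltnS -on_j.
Qed.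

End Decomposition.
Let misses n (a : mono n m.+1) : Prop := exists j, forall i, a i != j.

Let bdry_vert (S : {set B}) : reflect (exists j, vert j \notin S) (bdry bot S).
Proof.
apply: (iffP idP) => [|[j]]; rewrite /bdry negb_and negb_forall.
  case/orP => [/existsP[i iS]|botS]; last by exists ord_max; rewrite /vert /= ltnn.
  by exists (unvert (inl i)); rewrite unvertK.
rewrite /vert; case: ifP => _ jS; last by rewrite jS orbT.
by apply/orP; left; apply/existsP; exists (inord j).
Qed.

Let bdry_join n1 n2 (a : mono n1 m.+1) (x : nerve (poset_cat K) n2) :
  misses a -> bdry bot (verts (join_chain a x)).
Proof.
case=> j aj; apply/bdry_vert; exists j; apply/imsetP => -[k _ ejk].
have kn : k < n1.+1 by rewrite -(on_simplex_join a x) -[join_fun_chain _ _ _]ejk.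
have := aj (lpart k); rewrite -(vertK (a _)) -(join_chain_l a x) lpartK //.
by rewrite -[join_fun_chain _ _ _]ejk vertK eqxx.
Qed.

Let bdry_simplex n (a : mono n m.+1) : misses a -> bdry bot (verts (simplex_chain a)).
Proof.
case=> j aj; apply/bdry_vert; exists j; apply/imsetP => -[k _ ejk].
by have := aj k; rewrite -(vertK (a k)) -[vert (a k)]ejk vertK eqxx.
Qed.

Let misses_dec n (y : nerve (poset_cat B) n) :
  bdry bot (verts y) -> misses (dec_l y).
Proof.
case/bdry_vert=> j jy; have [h|h] := boolP (on_simplex (vtx y ord0)).
  by exists j => i; apply: contraNneq jy => <-; exact: dec_l_vtx.
by exists ord0 => i; rewrite dec_l_max.
Qed.

Let bdry_inr n (y : nerve (poset_cat P) n) :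
  bdry bot (verts (push (@cone_inr_le m P) y)).
Proof. by apply/bdry_vert; exists ord0; apply/imsetP => -[k]. Qed.

Section SliceOf.
Variables (S : pred {set B}) (g : forall n, nerve (poset_cat B) n -> C n).
Hypothesis natg : natural_on S g.
Hypothesis gF : forall n (y : nerve (poset_cat P) n),
  g (push (@cone_inr_le m P) y) = sfun F y.

(** This and [of_slices] are the two directions of the adjunction between join with K and slice over
    p. *)
Definition slice_of n (a : mono n m.+1)
  (Sa : forall r (x : nerve (poset_cat K) r), S (verts (join_chain a x))) :
  slice p n.
Proof.
exists (g (simplex_chain a)) (fun r (x : nerve (poset_cat K) r) => g (join_chain a x)).
- move=> r r' f x; rewrite -natg // join_chain_res; congr (g (join_chain _ _)).
  exact: mono_eq.
- by move=> r x; rewrite -natg // join_chain_inl.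
- move=> r x; rewrite -natg // join_chain_inr gF; congr (sfun F _).
  exact: (@chain_eq P).
Defined.

End SliceOf.

Definition of_slices (b : forall n, mono n m.+1 -> slice p n)
  n (y : nerve (poset_cat B) n) : C n :=
  res (dec y) (sl_join (b n (dec_l y)) (dec_r y)).

Lemma of_slices_join (A : forall k, mono k m.+1 -> Prop)
    (b : forall k, mono k m.+1 -> slice p k) :
  (forall k k' (f : mono k' k) (a : mono k m.+1), A k a ->
    b k' (mono_comp a f) = res f (b k a)) ->
  forall n n1 n2 (a : mono n1 m.+1) (x : nerve (poset_cat K) n2)
    (j : mono n (n1 + n2.+1)),
  A n1 a -> of_slices b (res j (join_chain a x)) = res j (sl_join (b n1 a) x).
Proof. by move=> natb n n1 n2 a x j Aa; exact: (dec_value natb Aa (erefl _)). Qed.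

Lemma of_slices_natural (A : forall k, mono k m.+1 -> Prop)
    (b : forall k, mono k m.+1 -> slice p k) (S : pred {set B}) :
  (forall k k' (f : mono k' k) (a : mono k m.+1), A k a ->
    b k' (mono_comp a f) = res f (b k a)) ->
  (forall n (y : nerve (poset_cat B) n), S (verts y) -> A n (dec_l y)) ->
  natural_on S (of_slices b).
Proof.
move=> natb SA n n' f y Sy; rewrite -{1}(decE y) -res_comp.
by rewrite (of_slices_join natb) ?res_comp //; exact: SA.
Qed.

Let vert_max : vert ord_max = inr bot.
Proof. by rewrite /vert /= ltnn. Qed.

Lemma fillers_of_extends :
  (forall b : smap (boundary m.+1) (slice p),
    (forall v : boundary m.+1 0, facets_mono v ord0 = ord_max ->
      sfun b v = infty_cube_cone F) -> extends b) ->
  forall g : forall n, nerve (poset_cat B) n -> C n,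
  natural_on (bdry bot) g ->
  (forall n (y : nerve (poset_cat P) n), g n (push (@cone_inr_le m P) y) = sfun F y) ->
  exists2 g' : forall n, nerve (poset_cat B) n -> C n,
    natural_on predT g' &
    forall n (x : nerve (poset_cat B) n), bdry bot (verts x) -> g' n x = g n x.
Proof.
move=> ext g natg gF.
have miss n (f : boundary m.+1 n) : misses (facets_mono f).
  by case: (facets_miss f) => j _ fj; exists j.
have miss_join n (f : boundary m.+1 n) r (x : nerve (poset_cat K) r) :
    bdry bot (verts (join_chain (facets_mono f) x)).
  exact: bdry_join.
pose b n (f : boundary m.+1 n) : slice p n := slice_of natg gF (@miss_join n f).
have b_nat n n' (f : mono n n') (x : boundary m.+1 n') : b n (res f x) = res f (b n' x).
  apply: slice_simplex_eq => [|r y] /=.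
    by rewrite -natg; [congr (g _ _); exact: chain_eq|exact: bdry_simplex].
  rewrite -natg // join_chain_res; congr (g _ (join_chain _ _)).
  by rewrite res_id.
have [|s hs] := ext (SMap b_nat).
  (* The last vertex corresponds to [bot], so the chains that occur lie in P, where g is F. *)
  move=> v hv; apply: slice_simplex_eq => [|r x] /=; rewrite -gF; congr (g _ _);
    apply: chain_eq => i; rewrite /vtx /=.
    by rewrite (ord1 i) hv vert_max.
  rewrite /join_fun_chain /cons_empty_fun; case: (splitP (m := 1) i) => k _ //.
  by rewrite (ord1 k) hv vert_max.
exists (of_slices (fun k a => res a s)).
  apply: (@of_slices_natural (fun _ _ => True)) => // k k' f a _.
  exact: res_comp.
move=> n y by_y; have [j aj] := misses_dec by_y.
have miss2 : exists2 j, predT j & forall i, dec_l y i != j by exists j.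
have e : b n (FacetsSimplex miss2) = res (dec_l y) s := hs _ (FacetsSimplex miss2).
by rewrite /of_slices -e /= -natg ?decE //; apply: bdry_join; exists j.
Qed.

Lemma extends_of_fillers (b : smap (boundary m.+1) (slice p)) :
  (forall v : boundary m.+1 0, facets_mono v ord0 = ord_max ->
      sfun b v = infty_cube_cone F) ->
  (forall g : forall n, nerve (poset_cat B) n -> C n,
    natural_on (bdry bot) g ->
    (forall n (y : nerve (poset_cat P) n), g n (push (@cone_inr_le m P) y) = sfun F y) ->
    exists2 g' : forall n, nerve (poset_cat B) n -> C n,
      natural_on predT g' &
      forall n (x : nerve (poset_cat B) n), bdry bot (verts x) -> g' n x = g n x) ->
  extends b.
Proof.
move=> b_last fill.
pose point n : mono n 0 := const_mono n (ord0 : 'I_1).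
pose missb n (a : mono n m.+1) := [exists j, [forall i, a i != j]].
have missP n (a : mono n m.+1) : missb n a -> exists2 j, predT j & forall i, a i != j.
  by case/existsP=> j /forallP aj; exists j.
(* Off the boundary [bt] takes a default value; naturality is claimed only where some vertex is
   missed. *)
pose bt n (a : mono n m.+1) : slice p n :=
  match decP (@idP (missb n a)) with
  | left h => sfun b (FacetsSimplex (missP n a h) : boundary m.+1 n)
  | right _ => res (point n) (infty_cube_cone F)
  end.
have btE n (f : boundary m.+1 n) : bt n (facets_mono f) = sfun b f.
  rewrite /bt; case: (decP _) => [h|[]].
    by congr (sfun b _); exact: facets_simplex_eq.
  by apply/existsP; case: (facets_miss f) => j _ fj; exists j; apply/forallP.
have natbt k k' (f : mono k' k) (a : mono k m.+1) : misses a ->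
    bt k' (mono_comp a f) = res f (bt k a).
  case=> j aj; have ma : exists2 j, predT j & forall i, a i != j by exists j.
  rewrite (btE k (FacetsSimplex ma)) -sfun_res -btE.
  by congr (bt _ _); exact: mono_eq.
have natg : natural_on (bdry bot) (of_slices bt).
  by apply: (@of_slices_natural (fun k a => misses a)) => // n y; exact: misses_dec.
have gF n (y : nerve (poset_cat P) n) :
    of_slices bt (push (@cone_inr_le m P) y) = sfun F y.
  set z := push _ y.
  (* A chain in P meets the simplex at most in its last vertex, where [b_last] supplies the cone of
     F. *)
  have dl i : dec_l z i = ord_max by [].
  have last_miss : exists2 j, predT j & forall i, const_mono 0 (ord_max : 'I_m.+2) i != j.
    by exists ord0.
  have e : bt n (dec_l z) = res (point n) (infty_cube_cone F).
    rewrite -(b_last (FacetsSimplex last_miss)) // -sfun_res -btE.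
    by congr (bt _ _); apply: mono_eq => i; rewrite dl.
  rewrite /of_slices e /= -!sfun_res; congr (sfun F _).
  apply: (@chain_eq P) => i.
  have hz : join_fun_chain (dec_l z) (dec_r z) (dec_fun z i) = inr (vtx y i).
    by rewrite -[LHS]/(vtx (res (dec z) (join_chain (dec_l z) (dec_r z))) i) decE.
  rewrite -[LHS]/(cons_empty_fun (dec_r z) (join_fun (point n) id (dec_fun z i))).
  move: hz; rewrite /dec_fun; case: ifP => [/eqP y0|_].
    move=> _; rewrite /join_fun (unsplitK (inl i : 'I_n.+1 + 'I_n.+1)).
    rewrite /cons_empty_fun (unsplitK (inl _ : 'I_1 + 'I_n.+1)).
    by apply: val_inj; rewrite /= y0.
  rewrite join_chain_r => -[<-]; rewrite /join_fun (unsplitK (inr i : 'I_n.+1 + 'I_n.+1)).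
  by rewrite /cons_empty_fun (unsplitK (inr _ : 'I_1 + 'I_n.+1)).
have [g' natg' g'g] := fill _ natg gF.
have g'F n (y : nerve (poset_cat P) n) : g' n (push (@cone_inr_le m P) y) = sfun F y.
  by rewrite g'g // bdry_inr.
exists (slice_of natg' g'F (a := mono_id m.+1) (fun _ _ => isT)).
move=> n f; have mf : misses (facets_mono f).
  by case: (facets_miss f) => j _ fj; exists j.
rewrite -btE; apply: slice_simplex_eq => [|r x] /=.
- rewrite -natg' //.
  (* [of_slices_join] speaks of joins only; joining with a vertex of K brings the base of the slice
     within its reach. *)
  pose x0 := @mkchain K 0 (fun _ => top) (fun _ _ _ => ple_refl (top : K)).
  have -> : res (facets_mono f) (simplex_chain (mono_id m.+1))
      = res (inl_mono n 0) (join_chain (facets_mono f) x0).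
    by rewrite join_chain_inl; exact: chain_eq.
  rewrite g'g ?(of_slices_join natbt) ?sl_inl //.
  by rewrite join_chain_inl; exact: bdry_simplex.
- rewrite -natg' // join_chain_res.
  have -> : join_chain (mono_comp (mono_id m.+1) (facets_mono f)) (res (mono_id r) x)
      = res (mono_id (n + r.+1)) (join_chain (facets_mono f) x).
    rewrite !res_id; congr (join_chain _ _); exact: mono_eq.
  rewrite res_id g'g ?(bdry_join _ mf) // -[join_chain _ x]res_id.
  by rewrite (of_slices_join natbt) // res_id.
Qed.

End Join.

Lemma infty_cartesian_has_fillers : infty_cartesian F <-> has_fillers (P := P) bot F.
Proof.
split=> [lim m|fill m b hb]; first exact/fillers_of_extends/lim.
exact: extends_of_fillers hb (fill m).
Qed.

End SliceFillers.

(** * Retracts of cubes *)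

Section Transport.
Variables (P P' : finposet) (bot : P) (bot' : P') (u : P -> P') (w : P' -> P).
Hypothesis u_le : forall x y, ple x y -> ple (u x) (u y).
Hypothesis w_le : forall x y, ple x y -> ple (w x) (w y).
Hypotheses (uK : cancel u w) (wK : cancel w u) (u_bot : u bot = bot').

Lemma has_fillers_iso (C : sset) (F : smap (nerve (poset_cat P)) C)
    (G : smap (nerve (poset_cat P')) C) :
  (forall n (y : nerve (poset_cat P) n), sfun F y = sfun G (push u_le y)) ->
  has_fillers bot' G -> has_fillers bot F.
Proof.
move=> FG fillG m g natg gF.
pose B := cone_poset m P; pose B' := cone_poset m P'.
pose cu (x : B) : B' := match x with inl i => inl i | inr p => inr (u p) end.
pose cw (x : B') : B := match x with inl i => inl i | inr p => inr (w p) end.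
have cu_le x y : ple x y -> ple (cu x) (cu y).
  by case: x y => [i|p] [j|q] //=; exact: u_le.
have cw_le x y : ple x y -> ple (cw x) (cw y).
  by case: x y => [i|p] [j|q] //=; exact: w_le.
have cuK : cancel cu cw by case=> [i|p] //=; rewrite uK.
have cwK : cancel cw cu by case=> [i|p] //=; rewrite wK.
have mem_cu x (S : {set B}) : (cu x \in cu @: S) = (x \in S).
  by rewrite mem_imset //; exact: can_inj cuK.
have mem_cw x (S : {set B'}) : (cw x \in cw @: S) = (x \in S).
  by rewrite mem_imset //; exact: can_inj cwK.
have bdry_cu (S : {set B}) : bdry bot' (cu @: S) = bdry bot S.
  rewrite /bdry -u_bot -[cone_inr (u bot)]/(cu (inr bot)) mem_cu.
  by congr (~~ (_ && _)); apply: eq_forallb => i; exact: (mem_cu (inl i)).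
have bdry_cw (S : {set B'}) : bdry bot (cw @: S) = bdry bot' S.
  by rewrite -bdry_cu -imset_comp (eq_imset (g := id)) ?imset_id.
have [|n y|g' natg' g'g] := fillG m (fun n x => g n (push cw_le x)).
- move=> n k f x bx; rewrite push_res; apply: natg.
  by rewrite verts_push bdry_cw.
- transitivity (g n (push (@cone_inr_le m P) (push w_le y))).
    by congr (g _ _); exact: chain_eq.
  rewrite gF FG; congr (sfun G _); apply: chain_eq => i.
  exact: wK.
exists (fun n x => g' n (push cu_le x)).
  by move=> n k f x _; rewrite push_res; exact: natg'.
move=> n x bx; rewrite g'g ?verts_push ?bdry_cu //.
by congr (g _ _); apply: chain_eq => i; exact: cuK.
Qed.

End Transport.

(** * Retracts of functors and the diagrams they induce on prisms *)

Record retract (A D : category) (F G : functor A D) := Retract {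
  sec : forall a, hom (F a) (G a);
  ret : forall a, hom (G a) (F a);
  sec_nat : forall a b (f : hom a b), cmp (fmap G f) (sec a) = cmp (sec b) (fmap F f);
  ret_nat : forall a b (f : hom a b), cmp (fmap F f) (ret a) = cmp (ret b) (fmap G f);
  secK : forall a, cmp (ret a) (sec a) = idm (F a) }.

Section RetractFunctor.
Variables (P : finposet) (D : category) (F G : functor (poset_cat P) D).
Variable r : retract F G.

Definition retract_ob (p : P) (s : option bool) : D := if s is Some _ then F p else G p.

Definition retract_map (p q : P) (s t : option bool) (h : ple p q) :
    hom (retract_ob p s) (retract_ob q t) :=
  match s, t return hom (retract_ob p s) (retract_ob q t) with
  | Some _, Some _ => @fmap _ _ F p q h
  | Some _, None => cmp (sec r q) (@fmap _ _ F p q h)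
  | None, Some _ => cmp (ret r q) (@fmap _ _ G p q h)
  | None, None => @fmap _ _ G p q h
  end.

Let fmapE (H : functor (poset_cat P) D) (p q s : poset_cat P) (f : hom p q)
  (g : hom q s) (h : hom p s) : fmap H h = cmp (fmap H g) (fmap H f).
Proof. by rewrite -fmap_cmp; congr (fmap H _); exact: bool_irrelevance. Qed.

Let fmap1 (H : functor (poset_cat P) D) (p : poset_cat P) (h : hom p p) :
  fmap H h = idm (H p).
Proof. by rewrite -fmap_id; congr (fmap H _); exact: bool_irrelevance. Qed.

Definition retract_functor : functor (poset_cat (prism P)) D.
Proof.
exists (fun x : poset_cat (prism P) => retract_ob x.1 x.2)
  (fun x y h => retract_map x.2 y.2 (proj1 (andP h))).
- by case=> p [b|] /=; rewrite fmap1.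
- move=> [p s] [q t] [o v] g f.
  set fp := proj1 (andP f); set gp := proj1 (andP g); set h := proj1 _.
  have E H := @fmapE H p q o fp gp h.
  case: s t v f g fp gp h E => [b|] [b'|] [b''|] f g fp gp h E /=.
  + exact: E.
  + by rewrite E cmpA.
  + by rewrite E -cmpA [cmp (fmap G _) _]cmpA sec_nat !cmpA secK cmp_idl.
  + by rewrite E !cmpA sec_nat.
  + by rewrite E !cmpA ret_nat.
  (* The composite G -> F -> G need not be the identity, but no outer level lies between the middle
     level and itself. *)
  + by exfalso; case: (b') f g {fp gp h E} => f g; [case/andP: g|case/andP: f].
  + by rewrite E cmpA.
  + exact: E.
Defined.

End RetractFunctor.

Section InftyRetract.
Variables (P : finposet) (bot : P).
Hypothesis bot_le : forall p, ple bot p.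
Variables (D : category) (C : sset) (quasiC : quasicategory C) (X : smap (nerve D) C).
Variables (F G : functor (poset_cat P) D) (r : retract F G).

Lemma has_fillers_retract_functor :
  has_fillers bot (scomp X (nerve_map G)) -> has_fillers bot (scomp X (nerve_map F)).
Proof.
apply: (@has_fillers_retract P bot bot_le C quasiC _ _
          (scomp X (nerve_map (retract_functor r)))) => n y.
  (* The chain is rewritten with levels that are visibly of the form [Some _], so that [retract_map]
     computes to F. *)
  move=> ends; pose b i := (vtx y i).2 == Some true.
  pose z i : prism P := ((vtx y i).1, Some (b i)).
  have zy i : z i = vtx y i.
    by have := ends i; rewrite /z /b; case: (vtx y i) => [p [[]|]].
  have z_le (i j : 'I_n.+1) : i <= j -> ple (z i) (z j).
    by move=> ij; rewrite !zy; exact: vtx_le.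
  have -> : y = mkchain z_le by apply: chain_eq.
  rewrite /=; congr (sfun X _); apply: Functor_eq => i j h /=.
  by congr (fmap F _); exact: bool_irrelevance.
rewrite /=; congr (sfun X _); apply: Functor_eq => i j h /=.
by congr (fmap G _); exact: bool_irrelevance.
Qed.

End InftyRetract.

(** * Power sets under an injection *)

Section Image.
Variables (T T' : finType) (e : T -> T') (e_inj : injective e) (I : {set T}).

Definition image_sub (J : powerset_cat I) : powerset_cat (e @: I) :=
  exist _ (e @: sval J) (imsetS e (svalP J)).

Definition image_functor : functor (powerset_cat I) (powerset_cat (e @: I)).
Proof.
by exists image_sub (fun J J' h => imsetS e h) => *; exact: bool_irrelevance.
Defined.

Lemma preimset_in (J : {set T'}) : J \subset e @: I -> e @^-1: J \subset I.
Proof.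
move=> /subsetP JI; apply/subsetP => x; rewrite inE => /JI.
by rewrite mem_imset.
Qed.

Lemma imset_preimset (J : {set T'}) : J \subset e @: I -> e @: (e @^-1: J) = J.
Proof.
move=> /subsetP JI; apply/setP => y; apply/imsetP/idP => [[x]|yJ].
  by rewrite inE => xJ ->.
by have /imsetP[x _ exy] := JI y yJ; exists x; rewrite // inE -exy.
Qed.

Lemma preimset_imset (J : {set T}) : e @^-1: (e @: J) = J.
Proof. by apply/setP => x; rewrite inE mem_imset. Qed.

Lemma has_fillers_image (C : sset) (G : smap (nerve (powerset_cat (e @: I))) C) :
  has_fillers (P := powerset_poset (e @: I)) (empty_vertex _) G ->
  has_fillers (P := powerset_poset I) (empty_vertex I)
    (scomp G (nerve_map image_functor)).
Proof.
pose u (J : powerset_poset I) : powerset_poset (e @: I) := image_sub J.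
pose w (J : powerset_poset (e @: I)) : powerset_poset I :=
  exist _ (e @^-1: sval J) (preimset_in (svalP J)).
have u_le x y : ple x y -> ple (u x) (u y) by exact: imsetS.
have w_le x y : ple x y -> ple (w x) (w y) by exact: preimsetS.
apply: (@has_fillers_iso (powerset_poset I) (powerset_poset (e @: I)) _ _ u w u_le w_le).
- by move=> J; apply: val_inj; exact: preimset_imset.
- by move=> J; apply: val_inj; exact: imset_preimset (svalP J).
- by apply: val_inj; exact: imset0.
- move=> n y; rewrite /=; congr (sfun G _).
  by apply: (@chain_eq (powerset_poset (e @: I))).
Qed.

Variables (C : category) (F : functor (powerset_cat I) C).
Variables (G : functor (powerset_cat (e @: I)) C).
Variable r : retract F (fcomp G image_functor).

(** The section carries a cone over F to a cone over G; its universal map, followed by the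
    retraction, is the map sought. It is unique because composing any solution with the section
    gives the universal map for G. *)
Lemma cartesian_retract : cartesian G -> cartesian F.
Proof.
pose K := nonempty_powerset_cat I; pose K' := nonempty_powerset_cat (e @: I).
have pre_sub (J : K') : (e @^-1: sval J \subset I) && (e @^-1: sval J != set0).
  have [JI J0] := andP (svalP J); rewrite preimset_in //=.
  by apply: contraNneq J0 => e0; rewrite -(imset_preimset JI) e0 imset0.
have im_sub (J : K) : (e @: sval J \subset e @: I) && (e @: sval J != set0).
  by have [JI J0] := andP (svalP J); rewrite imsetS // imset_eq0.
pose w (J : K') : K := exist _ (e @^-1: sval J) (pre_sub J).
pose v (J : K) : K' := exist _ (e @: sval J) (im_sub J).
(* Image and preimage are inverse only up to propositional equality, so the identifications are
   expressed as morphisms of the power set. *)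
have uw (J : K') : hom (image_functor (nonempty_incl I (w J))) (nonempty_incl _ J).
  by rewrite /= imset_preimset //; case/andP: (svalP J).
have w_le (J J' : K') (h : hom J J') : hom (w J) (w J') by exact: preimsetS.
have wv (J : K) : hom (w (v J)) J by rewrite /= preimset_imset.
have vu (J : K) : hom (nonempty_incl _ (v J)) (image_functor (nonempty_incl I J)).
  exact: subxx.
have b0 : hom (empty_vertex (e @: I)) (image_functor (empty_vertex I)) by exact: sub0set.
have b1 : hom (image_functor (empty_vertex I)) (empty_vertex (e @: I)).
  by rewrite /= imset0.
have fG (a b c d : powerset_cat (e @: I)) (h : hom b d) (h' : hom a b)
    (k : hom c d) (k' : hom a c) :
    cmp (fmap G h) (fmap G h') = cmp (fmap G k) (fmap G k').
  by rewrite -!fmap_cmp; congr (fmap G _); exact: bool_irrelevance.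
move=> limG l.
have leg_nat' (J J' : K') (h : hom J J') :
    cmp (fmap (fcomp G (nonempty_incl _)) h)
      (cmp (fmap G (uw J)) (cmp (sec r _) (leg l (w J))))
    = cmp (fmap G (uw J')) (cmp (sec r _) (leg l (w J'))).
  have e1 := sec_nat r
    (w_le _ _ h : hom (nonempty_incl I (w J)) (nonempty_incl I (w J'))).
  rewrite -(leg_nat l (w_le _ _ h)) (cmpA (sec r _)) -[cmp (sec r _) (fmap _ _)]e1 !cmpA.
  by congr (cmp (cmp _ _) _); exact: fG.
have [t [t_leg t_uniq]] := limG (Cone leg_nat').
exists (cmp (ret r _) (cmp (fmap G b0) t)); split=> [J|s s_leg].
  have e1 := ret_nat r (empty_to (nonempty_incl I J)).
  have e2 := sec_nat r (wv J : hom (nonempty_incl I (w (v J))) (nonempty_incl I J)).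
  have e3 : fmap (fcomp G image_functor)
        (wv J : hom (nonempty_incl I (w (v J))) (nonempty_incl I J))
      = cmp (fmap G (vu J)) (fmap G (uw (v J))).
    by rewrite -fmap_cmp; congr (fmap G _); exact: bool_irrelevance.
  have e4 : cmp (fmap (fcomp G image_functor) (empty_to (nonempty_incl I J))) (fmap G b0)
      = cmp (fmap G (vu J)) (fmap G (empty_to (nonempty_incl _ (v J)))) by exact: fG.
  rewrite cmpA [cmp (leg _ _) _]e1 -cmpA [X in cmp _ X]cmpA e4 -[X in cmp _ X]cmpA.
  have /= -> := t_leg (v J).
  rewrite [X in cmp _ X]cmpA -e3 [X in cmp _ X]cmpA e2 -cmpA.
  have /= -> := leg_nat l (wv J : hom (w (v J)) J).
  by rewrite (cmpA (ret r _)) [cmp (ret _ _) _](secK r (nonempty_incl I J)) cmp_idl.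
have e5 : cmp (fmap G b0) (fmap G b1) = idm _.
  by rewrite -fmap_cmp -fmap_id; congr (fmap G _); exact: bool_irrelevance.
rewrite (t_uniq (cmp (fmap G b1) (cmp (sec r _) s))).
  by rewrite (cmpA (fmap G b0)) e5 cmp_idl cmpA secK cmp_idl.
move=> J; rewrite -[RHS]/(cmp (fmap G (uw J)) (cmp (sec r _) (leg l (w J)))) -s_leg.
have e1 := sec_nat r (empty_to (nonempty_incl I (w J))).
transitivity (cmp (fmap G (uw J)) (cmp (cmp (fmap (fcomp G image_functor)
    (empty_to (nonempty_incl I (w J)))) (sec r _)) s)).
  by rewrite !cmpA; congr (cmp (cmp _ _) _); exact: fG.
by rewrite e1 -[in LHS]cmpA.
Qed.

End Image.

Lemma has_fillers_ext (P : finposet) (bot : P) (C : sset)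
    (F G : smap (nerve (poset_cat P)) C) :
  (forall n (y : nerve (poset_cat P) n), sfun F y = sfun G y) ->
  has_fillers bot F -> has_fillers bot G.
Proof.
by move=> FG fillF m g natg gG; apply: fillF => // n y; rewrite gG FG.
Qed.

(** * The cube of a symmetric object on a set of odd numbers *)

Section CubeRetract.
Variables (n : nat) (I : {set 'I_n.+1}) (properI : I \proper [set: 'I_n.+1]).

Definition spread (x : 'I_n.+1) : 'I_n.+1.*2.+1 := inord (x.*2 + (x \in I)).

Lemma val_spread x : spread x = x.*2 + (x \in I) :> nat.
Proof.
rewrite inordK // ltnS doubleS -addn2 leq_add //; last by case: (x \in I).
by rewrite leq_double -ltnS.
Qed.

Lemma half_spread x : (spread x)./2 = x.
Proof. by rewrite val_spread addnC half_bit_double. Qed.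

Lemma spread_inj : injective spread.
Proof. by move=> x y exy; apply: ord_inj; rewrite -half_spread exy half_spread. Qed.

Lemma odd_spread x : odd (spread x) = (x \in I).
Proof. by rewrite val_spread oddD odd_double oddb. Qed.

Lemma spread_odd y : y \in spread @: I -> odd y.
Proof. by case/imsetP => x xI ->; rewrite odd_spread. Qed.

(** Distinct odd numbers differ by at least 2. *)
Lemma spread_gapped : gapped (spread @: I).
Proof.
move=> i j /spread_odd io /spread_odd jo ij; rewrite ltn_neqAle ij andbT.
by apply: contraTneq jo => <- /=; rewrite io.
Qed.

Lemma spread_ord0 : ord0 \notin spread @: I.
Proof. by apply/negP => /spread_odd. Qed.

Lemma spread_ord_max : ord_max \notin spread @: I.
Proof. by apply/negP => /spread_odd; rewrite /= odd_double. Qed.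

Lemma spread_proper : spread @: I \proper [set: 'I_n.+1.*2.+1].
Proof.
apply/properP; split; first exact: subsetT.
by exists ord0; rewrite ?inE ?spread_ord0.
Qed.

(** Points outside the image of [spread] go to a point x0 outside I, which exists because I is
    proper; x0 avoids every subset J of I. *)
Lemma gather_exists : exists2 r : 'I_n.+1.*2.+1 -> 'I_n.+1,
  cancel spread r &
  forall (J : {set 'I_n.+1}) z, J \subset I -> z \notin spread @: J -> r z \notin J.
Proof.
case/properP: properI => _ [x0 _ x0I].
exists (fun z : 'I_n.+1.*2.+1 => if z == spread (inord z./2) then inord z./2 else x0).
  by move=> x; rewrite half_spread inord_val eqxx.
move=> J z /subsetP JI zJ; case: eqP => [ez|_]; last by apply: contra x0I; exact: JI.
by apply: contra zJ => hJ; rewrite ez imset_f.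
Qed.

Let incl_shape m (J : {set 'I_m.+1}) (pJ : J \proper [set: 'I_m.+1]) :
  functor (powerset_cat J) (op Upsilon) :=
  fcomp (op_functor Delta_to_Upsilon) (cube_shape pJ).

Lemma cube_shape_retract :
  inhabited (retract (incl_shape properI)
    (fcomp (incl_shape spread_proper) (image_functor spread I))).
Proof.
have [r rK r_notin] := gather_exists.
have nI := compl_neq0 properI; have nI' := compl_neq0 spread_proper.
pose u (J : powerset_cat I) : powerset_cat (spread @: I) := image_functor spread I J.
pose s (J : powerset_cat I) (a : 'I_(dim (~: sval (u J))).+1) : 'I_(dim (~: sval J)).+1 :=
  pos (~: sval J) (r (elt a)).
pose t (J : powerset_cat I) (a : 'I_(dim (~: sval J)).+1) : 'I_(dim (~: sval (u J))).+1 :=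
  pos (~: sval (u J)) (spread (elt a)).
have r_in J (a : 'I_(dim (~: sval (u J))).+1) : r (elt a) \in ~: sval J.
  rewrite inE r_notin ?(svalP J) //.
  by have := elt_in a (nI' (u J)); rewrite inE.
have s_in J (a : 'I_(dim (~: sval J)).+1) : spread (elt a) \in ~: sval (u J).
  rewrite inE mem_imset; last exact: spread_inj.
  by have := elt_in a (nI J); rewrite inE.
split; exists s t.
- move=> J J' h; apply: functional_extensionality => a /=.
  rewrite /s /= !posK //; first exact: r_in.
  have := elt_in a (nI' (u J')); rewrite !inE; apply: contra.
  exact: (subsetP (imsetS spread (h : sval J \subset sval J'))).
- move=> J J' h; apply: functional_extensionality => a /=.
  rewrite /t /= !posK //.
  have := elt_in a (nI J'); rewrite !inE; apply: contra.
  exact: (subsetP (h : sval J \subset sval J')).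
- move=> J; apply: functional_extensionality => a /=.
  by rewrite /s /t posK // rK eltK.
Qed.

Lemma cartesian_cubes_spread (C : category) (X : functor (op Upsilon) C) :
  cartesian_cubes (underlying X) spread_proper -> cartesian_cubes (underlying X) properI.
Proof.
have [r] := cube_shape_retract; apply: (cartesian_retract spread_inj).
exists (fun J => fmap X (sec r J)) (fun J => fmap X (ret r J)).
- move=> J J' h; apply: etrans (esym (fmap_cmp X _ _)) _.
  exact: etrans (congr1 (@fmap _ _ X _ _) (sec_nat r h)) (fmap_cmp X _ _).
- move=> J J' h; apply: etrans (esym (fmap_cmp X _ _)) _.
  exact: etrans (congr1 (@fmap _ _ X _ _) (ret_nat r h)) (fmap_cmp X _ _).
- move=> J; apply: etrans (esym (fmap_cmp X _ _)) _.
  exact: etrans (congr1 (@fmap _ _ X _ _) (secK r J)) (fmap_id X _).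
Qed.

Lemma infty_cartesian_cubes_spread (C : sset) (X : smap (nerve (op Upsilon)) C) :
  quasicategory C -> I != set0 ->
  infty_cartesian_cubes (infty_underlying X) spread_proper ->
  infty_cartesian_cubes (infty_underlying X) properI.
Proof.
move=> quasiC I0; have I'0 : spread @: I != set0 by rewrite imset_eq0.
have [r] := cube_shape_retract.
rewrite /infty_cartesian_cubes (infty_cartesian_has_fillers I0).
rewrite (infty_cartesian_has_fillers I'0) => /(has_fillers_image spread_inj) fill.
have bot_le (J : powerset_poset I) : @ple (powerset_poset I) (empty_vertex I) J.
  exact: sub0set.
have fill1 : has_fillers (P := powerset_poset I) (empty_vertex I)
    (scomp X (nerve_map (fcomp (incl_shape spread_proper) (image_functor spread I)))).
  apply: has_fillers_ext fill => q y.
  by rewrite /=; congr (sfun X _); exact: Functor_eq.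
have := has_fillers_retract_functor (P := powerset_poset I) bot_le quasiC
  (X := X) r fill1.
apply: has_fillers_ext => q y.
by rewrite /=; congr (sfun X _); exact: Functor_eq.
Qed.

End CubeRetract.

(** * Equivalence of the four Segal conditions *)

Lemma Segal_equivalences (P : cube_property) (k : nat) :
  (forall n (I : {set 'I_n.+1}) (properI : I \proper [set: 'I_n.+1]),
    I != set0 -> P _ _ (spread_proper I) -> P _ _ properI) ->
  [<-> lower_odd_Segal P k; lower_even_Segal P k;
       upper_even_Segal P k; upper_odd_Segal P k].
Proof.
move=> spreadP.
(* The formally weakest condition implies the strongest: it applies to [spread @: I], which is
   gapped, avoids both ends and has the cardinality of I. *)
have upper_lower : upper_odd_Segal P k -> lower_odd_Segal P k.
  move=> upper n I properI _ cardI; apply: spreadP.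
    by rewrite -card_gt0 cardI.
  apply: upper; [exact: spread_gapped| |exact: spread_ord0|exact: spread_ord_max].
  by rewrite card_imset //; exact: spread_inj.
tfae=> //.
- by move=> lower n I properI gI cI _; exact: lower.
(* Neither even condition formally contains the other, so the passage goes through the upper odd and
   the lower odd one. *)
- move=> lower n I properI gI cI _; apply: upper_lower => // n' I' pI' g' c' z' _.
  exact: lower.
- by move=> upper n I properI gI cI _; exact: upper.
Qed.

Theorem proposition3p15 (k : nat) (k_gt0 : 0 < k) :
  (forall C : category, has_finite_limits C ->
   forall X : functor (op Upsilon) C,
     let P := cartesian_cubes (underlying X) in
     [<-> lower_odd_Segal P k;
          lower_even_Segal P k;
          upper_even_Segal P k;
          upper_odd_Segal P k])
  /\
  (forall C : sset, quasicategory C -> has_finite_infty_limits C ->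
   forall X : smap (nerve (op Upsilon)) C,
     let P := infty_cartesian_cubes (infty_underlying X) in
     [<-> lower_odd_Segal P k;
          lower_even_Segal P k;
          upper_even_Segal P k;
          upper_odd_Segal P k]).
Proof.
split=> [C _ X P|C quasiC _ X P]; apply: Segal_equivalences => n I properI I0.
- exact: cartesian_cubes_spread.
- exact: infty_cartesian_cubes_spread.
Qed.
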